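(* Let $\mu$ be a nonzero finite Borel measure on $\mathbb{R}^d$. (i) Suppose a sequence $Q_{\vartheta_n}$, $\vartheta_n\in\Theta$, converges in variation to a probability measure $P=Q_{F,\theta}$, where $F$ is a face of $\operatorname{cc}(\mu)$ and $\theta\in\Theta_F$. Then $D(P\|Q_{\vartheta_n})$ goes to zero if it is eventually finite (i.e. finite for all sufficiently large $n$), and eventual finiteness is equivalent to $\vartheta_n\in\theta+\mathrm{M}(P)$ eventually. (ii) Let $\Xi\subseteq\Theta$ and let $P=Q_{F,\theta}$ with $F$ a face of $\operatorname{cc}(\mu)$ and $\theta\in\Theta_F$. Then $P$ belongs to the $rI$-closure $\operatorname{cl}_{rI}(\mathcal{E}_\Xi)$ if and only if $P$ belongs to the variation closure $\operatorname{cl}_v(\mathcal{E}_{\Xi\cap(\theta+\mathrm{M}(P))})$. (iii) Let $\Xi\subseteq\Theta$ be convex. Then $\operatorname{cl}_{rI}(\mathcal{E}_\Xi)$ contains every probability measure $P\in\operatorname{cl}_v(\mathcal{E}_\Xi)$ that satisfies $D(P\|Q)<\infty$ for some $Q\in\mathcal{E}_{\operatorname{ri}(\Xi)}$.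
   Context: For nonempty $B\subseteq\mathbb{R}^d$, $\operatorname{lin}(B)$ is the linear subspace obtained by shifting the affine hull of $B$ to contain the origin; $\operatorname{cl}$ is closure, $\operatorname{ri}$ relative interior. A face of a nonempty convex set $C$ is a nonempty convex subset $F\subseteq C$ such that $tx+(1-t)y\in F$ with $x,y\in C$, $0<t<1$ implies $x,y\in F$ ($F=C$ allowed). The convex support $\operatorname{cs}(\mu)$, resp. convex core $\operatorname{cc}(\mu)$, is the intersection of all closed convex sets, resp. all convex Borel sets, $C\subseteq\mathbb{R}^d$ with $\mu(C)=\mu(\mathbb{R}^d)$; $\operatorname{lin}(\mu)=\operatorname{lin}(\operatorname{cs}(\mu))$. $\Lambda(\vartheta)=\ln\int_{\mathbb{R}^d}e^{\langle\vartheta,x\rangle}\mu(dx)$, $\operatorname{dom}(\Lambda)=\{\Lambda<\infty\}$, $\Theta=\operatorname{dom}(\Lambda)\cap\operatorname{lin}(\mu)$, and $Q_\vartheta$ ($\vartheta\in\operatorname{dom}(\Lambda)$) is the probability measure with $\mu$-density $e^{\langle\vartheta,x\rangle-\Lambda(\vartheta)}$. For $\Xi\subseteq\Theta$, $\mathcal{E}_\Xi=\{Q_\vartheta:\vartheta\in\Xi\}$. For a face $F$ of $\operatorname{cc}(\mu)$ (for which $\mu(\operatorname{cl}(F))>0$), $\Lambda_F(\vartheta)=\ln\int_{\operatorname{cl}(F)}e^{\langle\vartheta,x\rangle}\mu(dx)$, $\operatorname{dom}(\Lambda_F)=\{\Lambda_F<\infty\}$, $\Theta_F=\operatorname{dom}(\Lambda_F)\cap\operatorname{lin}(F)$,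 and for $\theta\in\operatorname{dom}(\Lambda_F)$, $Q_{F,\theta}$ is the probability measure with density $e^{\langle\theta,x\rangle-\Lambda_F(\theta)}$ with respect to the restriction of $\mu$ to $\operatorname{cl}(F)$. For a probability measure $P$ on $\mathbb{R}^d$, $\mathrm{M}(P)=\{\tau\in\mathbb{R}^d:\langle\tau,\cdot\rangle\text{ is }P\text{-integrable}\}$ (a linear subspace). The $I$-divergence is $D(P\|Q)=\int\ln\frac{dP}{dQ}\,dP$ if $P\ll Q$ and $+\infty$ otherwise. For a set $\mathcal{S}$ of Borel probability measures on $\mathbb{R}^d$, $\operatorname{cl}_v(\mathcal{S})$ (variation closure), resp. $\operatorname{cl}_{rI}(\mathcal{S})$ (reverse $I$-closure, $rI$-closure), is the set of all probability measures $P$ for which there is a sequence $Q_n$ in $\mathcal{S}$ with total variation $|P-Q_n|\to0$, resp. with $D(P\|Q_n)\to0$. *)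

(* Defs.v *)
From HB Require Import structures.
From mathcomp Require Import all_boot all_order all_algebra.
From mathcomp Require Import all_classical all_reals all_analysis.

Set Implicit Arguments.
Unset Strict Implicit.
Unset Printing Implicit Defensive.

Import Order.TTheory GRing.Theory Num.Theory.
Import numFieldNormedType.Exports.

Local Open Scope classical_set_scope.
Local Open Scope ring_scope.

(* R^d is 'rV[R]_d with its Borel sigma-algebra; the ambient topology is the
   one of the sup norm, i.e. the Euclidean one. *)
HB.instance Definition _ (R : realType) (m n : nat) :=
  Measurable.copy 'M[R]_(m, n) (g_sigma_algebraType (@open 'M[R]_(m, n))).

Section ConvexGeometry.
Context {R : realType} {d : nat}.
Implicit Types B C F : set 'rV[R]_d.

Definition inner (x y : 'rV[R]_d) : R := \sum_(i < d) x ord0 i * y ord0 i.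

Definition affine_hull B : set 'rV[R]_d :=
  [set x | exists n (a : 'I_n -> R) (v : 'I_n -> 'rV[R]_d),
     [/\ forall i, B (v i), \sum_(i < n) a i = 1 &
         x = \sum_(i < n) a i *: v i]].

(* For nonempty B, the set affine_hull B - y is the same for every y in
   affine_hull B. *)
Definition lin B : set 'rV[R]_d :=
  [set x - y | x in affine_hull B & y in affine_hull B].

Definition ri B : set 'rV[R]_d :=
  [set x | B x /\ \forall y \near x, affine_hull B y -> B y].

Definition is_face C F : Prop :=
  [/\ F !=set0, convex_set (M := 'rV[R]_d) F, F `<=` C &
      forall x y (t : R), C x -> C y -> 0 < t < 1 ->
        F (t *: x + (1 - t) *: y) -> F x /\ F y].

Lemma measurable_closure B : measurable (closure B).
Proof.
rewrite -[closure B]setCK; apply: measurableC.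
by apply: sub_sigma_algebra; rewrite openC; exact: closed_closure.
Qed.

End ConvexGeometry.

Section Divergences.
Context {disp : measure_display} {T : measurableType disp} {R : realType}.
Local Open Scope ereal_scope.
Implicit Types P Q : probability T R.

Definition has_density P (nu : {measure set T -> \bar R}) (f : T -> R) : Prop :=
  forall A, measurable A -> P A = \int[nu]_(x in A) (f x)%:E.

(* |nu|(T); it does not depend on the chosen Hahn decomposition. *)
Definition total_variation_norm (nu : {charge set T -> \bar R}) : \bar R :=
  charge_variation (projT2 (cid (projT2 (cid (Hahn_decomposition nu)))))
    [set: T].

Definition tv_dist P Q : \bar R :=
  total_variation_norm
    (cadd (charge_of_finite_measure P) (copp (charge_of_finite_measure Q))).

Local Open Scope charge_scope.

Definition I_divergence P Q : \bar R :=
  if `[< P `<< Q >]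
  then \int[P]_x lne (('d (charge_of_finite_measure P) '/d Q) x)
  else +oo.

Definition cl_v (S : set (probability T R)) : set (probability T R) :=
  [set P | exists2 Q : nat -> probability T R,
     (forall n, S (Q n)) & tv_dist P (Q n) @[n --> \oo] --> 0].

Definition cl_rI (S : set (probability T R)) : set (probability T R) :=
  [set P | exists2 Q : nat -> probability T R,
     (forall n, S (Q n)) & I_divergence P (Q n) @[n --> \oo] --> 0].

End Divergences.

Section ExponentialFamily.
Context {R : realType} {d : nat}.
Implicit Types (nu : {measure set 'rV[R]_d -> \bar R}) (P : probability 'rV[R]_d R)
  (theta : 'rV[R]_d).

Definition Lambda nu theta : \bar R :=
  lne (\int[nu]_x (expR (inner theta x))%:E)%E.

Definition dom_Lambda nu : set 'rV[R]_d :=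
  [set theta | (Lambda nu theta < +oo)%E].

(* A predicate rather than a function of theta: a term of type probability also
   has values on non-Borel sets, which the density does not determine. On
   dom_Lambda nu, fine is harmless: Lambda nu theta is finite if nu is nonzero,
   and no probability has a density with respect to the zero measure. *)
Definition is_Q nu theta P : Prop :=
  dom_Lambda nu theta /\
  has_density P nu (fun x => expR (inner theta x - fine (Lambda nu theta))).

Definition M P : set 'rV[R]_d :=
  [set tau | P.-integrable [set: 'rV[R]_d] (fun x => (inner tau x)%:E)].

End ExponentialFamily.

Section Model.
Context {R : realType} {d : nat} (mu : {finite_measure set 'rV[R]_d -> \bar R}).
Implicit Types (F Xi : set 'rV[R]_d) (theta : 'rV[R]_d) (P : probability 'rV[R]_d R).

Definition convex_support : set 'rV[R]_d :=
  \bigcap_(C in [set C : set 'rV[R]_d | [/\ closed C,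
     convex_set (M := 'rV[R]_d) C & mu C = mu [set: 'rV[R]_d]]]) C.

Definition convex_core : set 'rV[R]_d :=
  \bigcap_(C in [set C : set 'rV[R]_d | [/\ measurable C,
     convex_set (M := 'rV[R]_d) C & mu C = mu [set: 'rV[R]_d]]]) C.

Definition Theta : set 'rV[R]_d := dom_Lambda mu `&` lin convex_support.

Definition expfam Xi : set (probability 'rV[R]_d R) :=
  [set P | exists2 theta, Xi theta & is_Q mu theta P].

Definition mu_cl F : {measure set 'rV[R]_d -> \bar R} :=
  mrestr mu (measurable_closure F).

Definition Theta_F F : set 'rV[R]_d := dom_Lambda (mu_cl F) `&` lin F.

Definition is_QF F theta P : Prop := is_Q (mu_cl F) theta P.

End Model.

Definition translate {R : realType} {d : nat} (a : 'rV[R]_d) (A : set 'rV[R]_d)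
  : set 'rV[R]_d := [set a + x | x in A].

(* Main.v *)
Require Import Defs.
From HB Require Import structures.
From mathcomp Require Import all_boot all_order all_algebra.
From mathcomp Require Import all_classical all_reals all_analysis.
From mathcomp Require Import measurable_realfun.
From mathcomp Require Import lra ring.

Set Implicit Arguments.
Unset Strict Implicit.
Unset Printing Implicit Defensive.

Import Order.TTheory GRing.Theory Num.Theory.
Import numFieldNormedType.Exports.

Local Open Scope classical_set_scope.
Local Open Scope ring_scope.

(* If [P] has density e^(<theta,x> - c) on a Borel set [K], then
   D(P || Q_vartheta) is the [P]-integral of the affine function
   <theta - vartheta, x> - (c - Lambda(vartheta)), whose negative part is always
   integrable; hence it is finite iff theta - vartheta lies in [M P].
   Convergence in variation gives, along subsequences, [P]-a.e. convergence of
   these affine functions to 0, and since [M P] has finite dimension the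
   integrals converge too: an affine combination of integrable coordinates
   vanishing pointwise in the limit agrees [P]-a.e. with one whose coefficients
   tend to 0. This gives (i), and (ii) follows with a Pinsker-type inequality.

   For (iii), ln dP/dmu is a pointwise limit of affine functions, so [P] again has
   an exponential density on some Borel set. If Q_{vartheta_n} -> P and
   D(P || Q_{y0}) is finite with y0 in ri Xi, then vartheta_n - y0 lies in [M P]
   up to a correction delta_n -> 0 in the directions of Xi. For fixed t in (0,1)
   the parameter (1-t) vartheta_n + t (y0 - ((1-t)/t) delta_n) is in Xi for large n
   and differs from y0 by an element of [M P]; by convexity of Lambda its
   divergence is at most an integral that converges to O(t). *)

(** * Linear algebra *)

Section Inner.
Context {R : realType} {d : nat}.
Implicit Types x y z : 'rV[R]_d.

Lemma innerE x y : inner x y = (x *m y^T) ord0 ord0.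
Proof. by rewrite mxE; apply: eq_bigr => i _; rewrite mxE. Qed.

Lemma innerDl x y z : inner (x + y) z = inner x z + inner y z.
Proof. by rewrite !innerE mulmxDl mxE. Qed.

Lemma innerNl x z : inner (- x) z = - inner x z.
Proof. by rewrite !innerE mulNmx mxE. Qed.

Lemma innerBl x y z : inner (x - y) z = inner x z - inner y z.
Proof. by rewrite innerDl innerNl. Qed.

Lemma innerZl a x z : inner (a *: x) z = a * inner x z.
Proof. by rewrite !innerE -scalemxAl mxE. Qed.

Lemma inner_suml n (F : 'I_n -> 'rV[R]_d) z :
  inner (\sum_i F i) z = \sum_i inner (F i) z.
Proof. by rewrite innerE mulmx_suml summxE; under eq_bigr do rewrite -innerE. Qed.

Lemma inner_cvg (b : nat -> 'rV[R]_d) (b0 : 'rV[R]_d) z :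
  (forall i, b n ord0 i @[n --> \oo] --> b0 ord0 i) ->
  inner (b n) z @[n --> \oo] --> inner b0 z.
Proof.
move=> bb0; apply: cvg_big; first exact: add_continuous.
by move=> i _; apply: cvgM (bb0 i) _; exact: cvg_cst.
Qed.

End Inner.

Section RowSpan.
Context {R : realType} {m : nat}.

(** Ranks of matrices with rows in [S] are bounded by [m]; at the maximal rank, appending a further
    element of [S] cannot enlarge the row space. As [S] is an arbitrary set, this picks finitely
    many spanning elements even where there is no linear structure. *)
Lemma max_rank_rows (S : set 'rV[R]_m) :
  exists k (X : 'M[R]_(k, m)), (forall i, S (row i X)) /\
    forall v, S v -> (v <= X)%MS.
Proof.
pose p r := `[< exists k (X : 'M[R]_(k, m)),
  (forall i, S (row i X)) /\ \rank X = r >].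
have p0 : exists r, p r.
  by exists 0; apply/asboolP; exists 0, 0; rewrite mxrank0; split=> // -[].
have pm r : p r -> (r <= m)%N.
  by move=> /asboolP[k [X [_ <-]]]; exact: rank_leq_col.
case: (ex_maxnP p0 pm) => r /asboolP[k [X [XS rX]]] rmax.
exists k, X; split=> // v Sv; apply/negP => /negP vX.
suff /rmax : p (\rank (col_mx X v)).
  apply/negP; rewrite -ltnNge -rX -addsmxE ltn_neqAle mxrankS ?addsmxSl// andbT.
  apply: contra vX => /eqP rE; have := mxrank_leqif_sup (addsmxSl X v).
  by case=> _; rewrite -rE eqxx addsmx_sub => /esym /andP[].
apply/asboolP; exists _, (col_mx X v); split=> // i.
have [j ->|j ->] := split_ordP i; first by rewrite rowKu.
by rewrite rowKd (_ : row j v = v)//; apply/rowP => l; rewrite !mxE (ord1 j).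
Qed.

Lemma pinvmx_inner_cvg k (X : 'M[R]_(k, m)) (y : nat -> 'rV[R]_k) (y0 : 'rV[R]_k) :
  (forall i, y n ord0 i @[n --> \oo] --> y0 ord0 i) ->
  forall j, (y n *m X) ord0 j @[n --> \oo] --> (y0 *m X) ord0 j.
Proof.
move=> yy0 j; rewrite mxE; under eq_fun do rewrite mxE.
apply: cvg_big; first exact: add_continuous.
by move=> i _; apply: cvgM (yy0 i) _; exact: cvg_cst.
Qed.

(** The [b n] may diverge in directions that [S] does not see. They are replaced by the coefficients
    that [pinvmx] recovers from the values at the spanning rows of [X], a fixed linear function of
    finitely many convergent numbers. *)
Lemma pointwise_cvg_coef (S : set 'rV[R]_m) (b : nat -> 'rV[R]_m)
    (l : 'rV[R]_m -> R) :
  (forall v, S v -> inner (b n) v @[n --> \oo] --> l v) ->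
  exists (b' : nat -> 'rV[R]_m) (b0 : 'rV[R]_m),
    [/\ forall n v, S v -> inner (b' n) v = inner (b n) v,
        forall i, b' n ord0 i @[n --> \oo] --> b0 ord0 i &
        forall v, S v -> l v = inner b0 v].
Proof.
move=> bl; have [k [X [XS XP]]] := max_rank_rows S.
pose b' n := b n *m X^T *m pinvmx X^T.
pose b0 := (\row_j l (row j X)) *m pinvmx X^T.
have b'E n v : S v -> inner (b' n) v = inner (b n) v.
  move=> /XP vX; rewrite !innerE -(mulmxKpV vX) trmx_mul !mulmxA.
  by rewrite -(mulmxA (b n)) /b' mulmxKpV ?submxMl// !mulmxA.
have b'b0 i : b' n ord0 i @[n --> \oo] --> b0 ord0 i.
  apply: pinvmx_inner_cvg => j; rewrite mxE.
  have := bl _ (XS j); apply: cvg_trans; apply: near_eq_cvg; near=> n.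
  by rewrite mxE; apply: eq_bigr => i' _; rewrite !mxE.
exists b', b0; split=> // v Sv; apply/esym.
apply: (@cvg_unique _ _ (nbhs (inner (b n) v @[n --> \oo]))) => //.
  rewrite -(_ : (fun n => inner (b' n) v) = (fun n => inner (b n) v)).
    exact: inner_cvg.
  by apply/funext => n; rewrite b'E.
exact: bl.
Unshelve. all: by end_near. Qed.

End RowSpan.

(** * Densities, total variation and divergence *)

Section Density.
Context {disp : measure_display} {T : measurableType disp} {R : realType}.
Variable mu : {finite_measure set T -> \bar R}.
Implicit Types (P Q : probability T R) (f g : T -> R).
Local Open Scope ereal_scope.

Lemma ge0_integral_mrestr (K A : set T) (mK : measurable K) (f : T -> \bar R) :
  measurable A -> measurable_fun A f -> (forall x, A x -> 0 <= f x) ->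
  \int[mrestr mu mK]_(x in A) f x = \int[mu]_(x in A `&` K) f x.
Proof.
move=> mA mf f0.
have nK : mrestr mu mK (~` K) = 0 by rewrite /mrestr setICl measure0.
rewrite (ge0_negligible_integral (measurableC mK) mA mf f0 nK).
rewrite setDE setCK; apply: eq_measure_integral => B mB BAK.
by rewrite /= /mrestr setIidl// => x /BAK[].
Qed.

(** Moves the restriction into an indicator, so that all densities refer to the one measure [mu]. *)
Lemma has_density_mrestr (K : set T) (mK : measurable K) P f :
  measurable_fun [set: T] f -> (forall x, 0 <= f x)%R ->
  has_density P (mrestr mu mK) f ->
  has_density P mu (fun x => \1_K x * f x)%R.
Proof.
move=> mf f0 Pf A mA; rewrite Pf// ge0_integral_mrestr//; last first.
- by move=> x _; rewrite lee_fin.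
- exact/measurable_EFinP/measurable_funTS.
rewrite integral_mkcondr; apply: eq_integral => x _.
rewrite patchE indicE; case: ifP => _; rewrite ?mul1r//.
by rewrite mul0r.
Qed.

Lemma density_dominates P f :
  measurable_fun [set: T] f -> has_density P mu f -> P `<< mu.
Proof.
move=> mf Pf; apply/null_content_dominatesP => A mA A0.
by rewrite Pf// null_set_integral//; exact/measurable_EFinP/measurable_funTS.
Qed.

Lemma density_integrable P f :
  measurable_fun [set: T] f -> (forall x, 0 <= f x)%R ->
  has_density P mu f -> mu.-integrable [set: T] (EFin \o f).
Proof.
move=> mf f0 Pf; apply/integrableP; split; first exact/measurable_EFinP.
under eq_integral do rewrite /= ger0_norm//.
by rewrite -Pf// probability_setT ltry.
Qed.

(** By uniqueness of densities, [f] agrees [mu]-a.e. with the Radon-Nikodym derivative, for which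
    the change of variables is available. *)
Lemma ge0_integral_density P f (g : T -> \bar R) :
  measurable_fun [set: T] f -> (forall x, 0 <= f x)%R -> has_density P mu f ->
  (forall x, 0 <= g x) -> measurable_fun [set: T] g ->
  \int[P]_x g x = \int[mu]_x (g x * (f x)%:E).
Proof.
move=> mf f0 Pf g0 mg; have Pmu := density_dominates mf Pf.
rewrite -(Radon_Nikodym_SigmaFinite.change_of_variables Pmu)//.
have ih := Radon_Nikodym_SigmaFinite.f_integrable Pmu.
apply: ae_eq_integral => //.
- by apply: emeasurable_funM => //; exact: measurable_int ih.
- by apply: emeasurable_funM => //; exact/measurable_EFinP.
apply: ae_eqe_mul2l; apply: integral_ae_eq => //.
- exact/measurable_EFinP.
- by move=> E _ mE; rewrite -Pf// -Radon_Nikodym_SigmaFinite.f_integral.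
Qed.

End Density.

(** * Total variation and almost everywhere convergence of densities *)

Section TotalVariation.
Context {disp : measure_display} {T : measurableType disp} {R : realType}.
Implicit Types P Q : probability T R.
Local Open Scope ereal_scope.

Lemma abse_sub_le_tv P Q A : measurable A -> `|P A - Q A| <= tv_dist P Q.
Proof.
move=> mA; rewrite /tv_dist /total_variation_norm.
set nu := cadd _ _; set h := projT2 (cid (projT2 (cid (Hahn_decomposition nu)))).
have -> : P A - Q A = nu A by [].
apply: le_trans (abse_charge_variation h mA) _.
by apply: le_measure; rewrite ?inE.
Qed.

(** A one-sided bound is enough because both measures have mass 1: on the negative set of a Hahn
    decomposition, [Q] minus [P] equals [P] minus [Q] on the complement. *)
Lemma tv_le P Q (e : R) :
  (forall A, measurable A -> P A - Q A <= e%:E) -> tv_dist P Q <= (e + e)%:E.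
Proof.
move=> PQ; rewrite /tv_dist /total_variation_norm.
set nu := cadd _ _; set h := projT2 (cid (projT2 (cid (Hahn_decomposition nu)))).
have [mp mn] : measurable (projT1 (cid (Hahn_decomposition nu))) /\
    measurable (projT1 (cid (projT2 (cid (Hahn_decomposition nu))))).
  by case: (h) => -[? _] [? _] _ _.
rewrite /charge_variation/= EFinD; apply: leeD.
  rewrite jordan_posE cjordan_posE /crestr0 mem_set//= /crestr setTI.
  exact: PQ.
rewrite jordan_negE cjordan_negE /crestr0 mem_set//= /crestr setTI.
set N := projT1 _ in mn *.
apply: le_trans (PQ _ (measurableC mn)).
rewrite /nu /cadd/= /copp/= /charge_of_finite_measure !probability_setC//.
have fP := fin_num_measure P _ mn; have fQ := fin_num_measure Q _ mn.
rewrite -(fineK fP) -(fineK fQ) -!EFinB lee_fin; lra.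
Qed.

Lemma tv_ge0 P Q : 0 <= tv_dist P Q.
Proof. by apply: le_trans (abse_sub_le_tv P Q measurable0); exact: abse_ge0. Qed.

(** The thresholds are summable, as needed to extract a.e. convergent densities. *)
Lemma tv_cvg0_near P (Q : nat -> probability T R) :
  tv_dist P (Q n) @[n --> \oo] --> 0 ->
  forall k, \forall n \near \oo, tv_dist P (Q n) <= (1 / (2 ^ k.+1)%:R)%:E.
Proof.
move=> /fine_cvgP[tvfin /cvgrPdist_le tv0] k.
have k0 : (0 < 1 / (2 ^ k.+1)%:R :> R)%R by rewrite divr_gt0// ltr0n expn_gt0.
apply: filterS2 tvfin (tv0 _ k0) => n fn.
rewrite sub0r normrN => h; rewrite -(fineK fn) lee_fin.
exact: le_trans (ler_norm _) h.
Qed.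

Variable mu : {finite_measure set T -> \bar R}.

(** Split at the set where [q <= p]: on either part the integral is a difference of probabilities,
    hence at most the variation. The factor 2 is not sharp, which is harmless here. *)
Lemma L1_le_tv P Q (p q : T -> R) :
  measurable_fun [set: T] p -> measurable_fun [set: T] q ->
  (forall x, 0 <= p x)%R -> (forall x, 0 <= q x)%R ->
  has_density P mu p -> has_density Q mu q ->
  \int[mu]_x (`|p x - q x|)%:E <= 2%:E * tv_dist P Q.
Proof.
move=> mp mq p0 q0 Pp Qq.
have ip := density_integrable mp p0 Pp; have iq := density_integrable mq q0 Qq.
pose E := [set x | (q x <= p x)%R].
have mE : measurable E by rewrite -[E]setTI; exact: measurable_fun_le.
have mpq : measurable_fun [set: T] (fun x => (`|p x - q x|)%:E).
  by apply/measurable_EFinP; apply: measurableT_comp => //; exact: measurable_funB.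
have mEC := measurableC mE.
rewrite -(setUv E) (ge0_integral_setU _ mE mEC); last 3 first.
- by rewrite setUv.
- by move=> x _; rewrite lee_fin.
- by apply/disj_setPCl.
have -> : \int[mu]_(x in E) (`|p x - q x|)%:E = P E - Q E.
  rewrite Pp// Qq// -integralB_EFin//; [|exact: integrableS ip|exact: integrableS iq].
  by apply: eq_integral => x /set_mem; rewrite /E/= -subr_ge0 => /ger0_norm ->.
have -> : \int[mu]_(x in ~` E) (`|p x - q x|)%:E = Q (~` E) - P (~` E).
  rewrite Pp// Qq// -integralB_EFin//; [|exact: integrableS iq|exact: integrableS ip].
  apply: eq_integral => x /set_mem; rewrite /E/= => /negP.
  by rewrite -ltNge -subr_lt0 => /ltW /ler0_norm ->; rewrite opprB.
rewrite mule_natl mule2n; apply: leeD.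
  exact: le_trans (lee_abs _) (abse_sub_le_tv _ _ _).
apply: le_trans (abse_sub_le_tv P Q mEC).
have fP := fin_num_measure P _ mEC; have fQ := fin_num_measure Q _ mEC.
by rewrite -(fineK fP) -(fineK fQ) -!EFinB abse_EFin lee_fin distrC ler_norm.
Qed.

(** The distances in L1 are summable, so the series of the |p - q_n| is integrable, hence finite
    a.e., and its terms tend to 0. *)
Lemma ae_cvg_of_tv P (Q : nat -> probability T R) (p : T -> R) (q : nat -> T -> R) :
  measurable_fun [set: T] p -> (forall n, measurable_fun [set: T] (q n)) ->
  (forall x, 0 <= p x)%R -> (forall n x, 0 <= q n x)%R ->
  has_density P mu p -> (forall n, has_density (Q n) mu (q n)) ->
  (forall n, tv_dist P (Q n) <= (1 / (2 ^ n.+1)%:R)%:E) ->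
  {ae mu, forall x, q n x @[n --> \oo] --> p x}.
Proof.
move=> mp mq p0 q0 Pp Qq tvPQ.
pose f n x := (`|p x - q n x|)%:E.
have mf n : measurable_fun [set: T] (f n).
  by apply/measurable_EFinP; apply: measurableT_comp => //; exact: measurable_funB.
have f0 n x : 0 <= f n x by rewrite lee_fin.
have iS : mu.-integrable [set: T] (fun x => \sum_(n <oo) f n x).
  apply/integrableP; split.
    by apply: ge0_emeasurable_sum => // n x _ _; exact: f0.
  under eq_integral do rewrite gee0_abs ?nneseries_ge0//.
  rewrite integral_nneseries//.
  apply: (@le_lt_trans _ _ (2%:E * \sum_(n <oo) (1 / (2 ^ n.+1)%:R)%:E)).
    rewrite -nneseriesZl => [|n _]; last by rewrite lee_fin.
    apply: lee_nneseries => [n _ _|n _]; first exact: integral_ge0.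
    apply: le_trans (L1_le_tv _ _ _ _ Pp (Qq n)) _ => //.
    by rewrite lee_pmul2l.
  apply: (@le_lt_trans _ _ (2%:E * 1%:E)); last by rewrite ltry.
  by rewrite lee_pmul2l//; exact: epsilon_trick0.
have := integrable_ae measurableT iS.
apply: filterS => x /(_ I) Sx.
suff : (`|p x - q n x| @[n --> \oo] --> 0)%R.
  move/cvgr0Pnorm_lt => h; apply/cvgrPdist_lt => e /h.
  by apply: filterS => n; rewrite normr_id.
apply: cvg_series_cvg_0; apply: nondecreasing_is_cvgn.
  by apply/nondecreasing_seqP => n; rewrite /series/= big_nat_recr//= lerDl.
exists (fine (\sum_(n <oo) f n x)) => _ [k _ <-].
rewrite -lee_fin fineK//= /series/= -sumEFin.
exact: nneseries_lim_ge.
Qed.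

End TotalVariation.

(** * The divergence as the integral of a log-likelihood ratio *)

Section LogLikelihoodRatio.
Context {disp : measure_display} {T : measurableType disp} {R : realType}.
Variables (mu : {finite_measure set T -> \bar R}) (P Q : probability T R).
Variables (K : set T) (a b : T -> R).
Hypotheses (mK : measurable K) (ma : measurable_fun [set: T] a)
  (mb : measurable_fun [set: T] b).
Hypothesis Pa : has_density P mu (fun x => \1_K x * expR (a x)).
Hypothesis Qb : has_density Q mu (fun x => expR (b x)).
Local Open Scope ereal_scope.

Let mexp (f : T -> R) : measurable_fun [set: T] f ->
  measurable_fun [set: T] (fun x => expR (f x)).
Proof. by move=> mf; exact: (measurableT_comp (@measurable_expR R)). Qed.

Let mind (A : set T) : measurable A ->
  measurable_fun [set: T] (\1_A : T -> R).
Proof. by move=> mA; exact: measurable_indic. Qed.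

Let mab : measurable_fun [set: T] (fun x => a x - b x)%R.
Proof. exact: measurable_funB. Qed.

Let mba : measurable_fun [set: T] (fun x => - (a x - b x))%R.
Proof. exact: measurableT_comp. Qed.

Let mPa : measurable_fun [set: T] (fun x => \1_K x * expR (a x))%R.
Proof. by apply: measurable_funM; [exact: mind|exact: mexp]. Qed.

Let Pa0 x : (0 <= \1_K x * expR (a x) :> R)%R.
Proof. by rewrite mulr_ge0 ?expR_ge0. Qed.

Lemma density_ratio : has_density P Q (fun x => \1_K x * expR (a x - b x))%R.
Proof.
move=> A mA; rewrite Pa// [LHS]integral_mkcond [RHS]integral_mkcond.
rewrite (ge0_integral_density (mexp mb) _ Qb).
- apply: eq_integral => x _; rewrite !patchE; case: ifP => _; last by rewrite mul0e.
  rewrite -EFinM -mulrA -expRD subrK. by [].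
- by move=> x; exact: expR_ge0.
- by move=> x; rewrite patchE; case: ifP => // _; rewrite lee_fin mulr_ge0 ?expR_ge0.
- apply/(measurable_restrictT _ _).1 => //; apply: measurable_funTS.
  by apply/measurable_EFinP; apply: measurable_funM; [exact: mind|exact: mexp].
Qed.

Let mratio : measurable_fun [set: T] (fun x => \1_K x * expR (a x - b x))%R.
Proof. by apply: measurable_funM; [exact: mind|exact: mexp]. Qed.

Lemma density_ratio_dominates : P `<< Q.
Proof. exact: density_dominates mratio density_ratio. Qed.

Lemma ae_density_support : {ae P, forall x, K x}.
Proof.
exists (~` K); split; first exact: measurableC; last by [].
rewrite /= Pa; last exact: measurableC.
apply: integral0_eq => x /= Kx; rewrite indicE memNset// mul0r//.
Qed.

(** The Radon-Nikodym derivative equals the explicit ratio [Q]-a.e., hence [P]-a.e. by domination;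
    on [K], which carries all the mass of [P], its logarithm is [a - b]. *)
Lemma I_divergenceE : I_divergence P Q = \int[P]_x (a x - b x)%:E.
Proof.
have PQ := density_ratio_dominates.
rewrite /I_divergence asboolT//.
set g := Radon_Nikodym _ _.
have ig : Q.-integrable [set: T] g by exact: Radon_Nikodym_integrable.
have fg x : g x \is a fin_num by exact: Radon_Nikodym_fin_num.
have mg : measurable_fun [set: T] g by exact: measurable_int ig.
have gE : ae_eq P [set: T] g (fun x => (\1_K x * expR (a x - b x))%:E).
  apply: null_dominates_ae_eq measurableT PQ _.
  apply: integral_ae_eq => //; first exact/measurable_EFinP.
  move=> E _ mE; rewrite /g -Radon_Nikodym_integral//=.
    exact: density_ratio.
  exact: density_ratio_dominates.
apply: ae_eq_integral => //.
(* [lne] is spelled out as a case distinction to obtain measurability: it takes the value -oo at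
   nonpositive arguments. *)
- rewrite (_ : (fun x => _) =
      (fun x => if (fine (g x) <= 0)%R then -oo else (ln (fine (g x)))%:E)).
    have mfg : measurable_fun [set: T] (fun x => fine (g x)).
      exact: measurableT_comp.
    apply: measurable_fun_ifT => //.
      exact: measurable_fun_ler.
    by apply/measurable_EFinP; apply: measurableT_comp mfg; exact: measurable_ln.
  by apply/funext => x; rewrite -(fineK (fg x)).
- exact/measurable_EFinP.
- apply: filterS2 ae_density_support gE => x Kx /(_ I) -> _.
  by rewrite indicE mem_set// mul1r lne_EFin ?expR_gt0// expRK.
Qed.

(** The inverse ratio recovers [Q] on [K] only, since [Q] may charge the complement of [K]. This
    still bounds its [P]-integral by 1. *)
Lemma integral_density_ratioV A : measurable A ->
  \int[P]_(x in A) (expR (- (a x - b x)))%:E = Q (A `&` K).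
Proof.
move=> mA; rewrite Qb; last exact: measurableI.
rewrite [LHS]integral_mkcond [RHS]integral_mkcond (ge0_integral_density mPa Pa0 Pa).
- apply: eq_integral => x _; rewrite !patchE in_setI indicE.
  case: (x \in A) => /=; last by rewrite mul0e.
  case: (x \in K) => /=; rewrite ?mul1r ?mul0r ?mule0// -EFinM -expRD.
  by rewrite opprB subrK.
- by move=> x; rewrite patchE; case: ifP => // _; rewrite lee_fin expR_ge0.
- apply/(measurable_restrictT _ _).1 => //; apply: measurable_funTS.
  by apply/measurable_EFinP; exact: mexp.
Qed.

Lemma integrable_density_ratioV :
  P.-integrable [set: T] (fun x => (expR (- (a x - b x)))%:E).
Proof.
apply/integrableP; split; first by apply/measurable_EFinP; exact: mexp.
under eq_integral do rewrite /= ger0_norm ?expR_ge0//.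
rewrite integral_density_ratioV// (le_lt_trans (probability_le1 _ _)) ?ltry//.
exact: measurableI.
Qed.

(** From -l <= 1 - l <= e^(-l), the negative part is below the inverse ratio, which is
    integrable. *)
Lemma integral_loglik_funeneg :
  \int[P]_x (fun x => (a x - b x)%:E)^\- x \is a fin_num.
Proof.
rewrite ge0_fin_numE; last by apply: integral_ge0.
apply: le_lt_trans (integrable_lty _ integrable_density_ratioV) => //.
apply: ge0_le_integral => //.
- by apply/measurable_funeneg/measurable_EFinP.
- by apply/measurable_EFinP; exact: mexp.
- move=> x _; rewrite funenegE -EFinN.
  rewrite ge_max !lee_fin expR_ge0 andbT.
  by apply: le_trans (expR_ge1Dx _); rewrite lerDr.
Qed.

(** With the negative part always finite, a divergence below +oo forces a finite positive part,
    hence absolute integrability. *)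
Lemma I_divergence_lty : I_divergence P Q < +oo ->
  P.-integrable [set: T] (fun x => (a x - b x)%:E).
Proof.
rewrite I_divergenceE integralE => h; apply/integrableP; split.
  exact/measurable_EFinP.
rewrite (_ : \int[P]_x _ = \int[P]_x
    ((fun x => (a x - b x)%:E)^\+ x + (fun x => (a x - b x)%:E)^\- x)); last first.
  apply: eq_integral => x _; rewrite -[RHS]/((_ \+ _) x).
  by rewrite -(fune_abse (fun x => (a x - b x)%:E)).
rewrite ge0_integralD//; [|exact/measurable_funepos/measurable_EFinP|
  exact/measurable_funeneg/measurable_EFinP].
have hN := integral_loglik_funeneg.
rewrite lte_add_pinfty//; last by rewrite -ge0_fin_numE// integral_ge0.
rewrite lteBlDr// in h.
rewrite addye// in h.
by rewrite gt_eqF// (lt_le_trans ltNy0)// integral_ge0.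
Qed.

Hypothesis iab : P.-integrable [set: T] (fun x => (a x - b x)%:E).

Lemma I_divergence_fin_num : I_divergence P Q \is a fin_num.
Proof. by rewrite I_divergenceE; exact: integrable_fin_num iab. Qed.

Let iV := integrable_density_ratioV.

Let V_le1 : (\int[P]_x expR (- (a x - b x)) <= 1)%R.
Proof.
rewrite -lee_fin fineK; last exact: integrable_fin_num iV.
by rewrite integral_density_ratioV// probability_le1//; exact: measurableI.
Qed.

(** Integrate l >= 1 - e^(-l), where e^(-l) has integral at most 1. *)
Lemma I_divergence_ge0 : 0 <= I_divergence P Q.
Proof.
rewrite I_divergenceE -(fineK (integrable_fin_num measurableT iab)) lee_fin.
have i1 : P.-integrable [set: T] (EFin \o (fun=> 1%R : R)).
  exact: finite_measure_integrable_cst.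
have i1V : P.-integrable [set: T] (EFin \o (fun x => 1 - expR (- (a x - b x)))%R).
  exact: (integrableB measurableT i1 iV).
have : (\int[P]_x (1 - expR (- (a x - b x))) <= \int[P]_x (a x - b x))%R.
  apply: le_Rintegral => // x _.
  by have := expR_ge1Dx (- (a x - b x)); lra.
apply: le_trans; rewrite (RintegralB measurableT i1 iV).
rewrite (Rintegral_cst P measurableT 1%R).
have -> : fine (P [set: T]) = 1%R by rewrite probability_setT.
by rewrite mul1r subr_ge0 V_le1.
Qed.

(* With s = sqrt (dQ/dP) one has -2 ln s >= 2 (1 - s), and (1 - s)(1 + s) is
   bounded by AM-GM. *)
Let loglik_AMGM (e x : R) : (0 < e)%R ->
  (1 <= (4 * e)^-1 * x + ((4 * e)^-1 + 2 * e + 1) * expR (- x)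
     + (2 * e - (4 * e)^-1))%R.
Proof.
move=> e0; have hs := expR_ge1Dx (- x / 2)%R.
have -> : (expR (- x) = expR (- x / 2) ^+ 2)%R.
  by rewrite expr2 -expRD -splitr.
move: hs; set s := expR _ => hs; have s0 : (0 < s)%R by exact: expR_gt0.
have en0 : e != 0%R by rewrite gt_eqF.
rewrite -(ler_pM2l (_ : 0 < 4 * e)%R); last by lra.
have -> : (4 * e * ((4 * e)^-1 * x + ((4 * e)^-1 + 2 * e + 1) * s ^+ 2
   + (2 * e - (4 * e)^-1)) = x + s ^+ 2 - 1 + 8 * e ^+ 2 * (1 + s ^+ 2)
     + 4 * e * s ^+ 2)%R by field.
(* Since x >= 2 (1 - s), the right side exceeds 4 e by at least this square plus four times the next
   one. *)
have h1 := sqr_ge0 (1 - s - 2 * e * (1 + s))%R.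
have h2 := sqr_ge0 (e * (1 - s))%R.
nra.
Qed.

(** A linearised Pinsker inequality; choosing [e] of the order of the square root of the divergence
    gives the usual rate. A nonnegative remainder [r] with 1 <= e^(-l) + r is integrated over [A]:
    the exponential yields at most [Q A], and [r] yields the right side. *)
Lemma sub_le_I_divergence (e : R) A : (0 < e)%R -> measurable A ->
  P A - Q A <= ((4 * e)^-1)%:E * I_divergence P Q + (4 * e)%:E.
Proof.
move=> e0 mA; set D := I_divergence P Q.
have fD := I_divergence_fin_num.
have i1 k B : measurable B -> P.-integrable B (EFin \o (fun=> k : R)).
  by move=> mB; exact: finite_measure_integrable_cst.
(* The coefficients of [loglik_AMGM] after one copy of e^(-l) is split off; [c2 + c3] is the
   constant 4 e of the conclusion. *)
set c1 := ((4 * e)^-1)%R; set c2 := (c1 + 2 * e)%R; set c3 := (2 * e - c1)%R.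
have i1L : P.-integrable [set: T] (EFin \o (fun x => c1 * (a x - b x))%R).
  exact: (integrableZl measurableT c1 iab).
have i2V : P.-integrable [set: T] (EFin \o (fun x => c2 * expR (- (a x - b x)))%R).
  exact: (integrableZl measurableT c2 iV).
pose r x := (c1 * (a x - b x) + c2 * expR (- (a x - b x)) + c3)%R.
have i12 := integrableD measurableT i1L i2V.
have ir : P.-integrable [set: T] (EFin \o r).
  exact: (integrableD measurableT i12 (i1 c3 _ measurableT)).
have rE : (\int[P]_x r x <= c1 * fine D + 4 * e)%R.
  rewrite (RintegralD measurableT i12 (i1 c3 _ measurableT)).
  rewrite (RintegralD measurableT i1L i2V) !RintegralZl//.
  rewrite (Rintegral_cst P measurableT c3).
  have -> : fine (P [set: T]) = 1%R by rewrite probability_setT.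
  rewrite /D I_divergenceE -[fine _]/(\int[P]_x (a x - b x))%R -addrA lerD2l.
  have : (c2 * \int[P]_x expR (- (a x - b x)) <= c2 * 1)%R.
    by rewrite ler_wpM2l// addr_ge0 ?invr_ge0//; lra.
  by rewrite /c3 /c2; lra.
have c10 : (0 <= c1)%R by rewrite invr_ge0; lra.
have r0 x : (0 <= r x)%R.
  have := expR_ge1Dx (- (a x - b x)); have := expR_ge0 (- (a x - b x)).
  by rewrite /r /c2 /c3; set u := expR _; set l := (a x - b x)%R; nra.
have r1 x : (1 <= expR (- (a x - b x)) + r x)%R.
  by have := loglik_AMGM (a x - b x) e0; rewrite -/c1 /r /c2 /c3; lra.
have iVA : P.-integrable A (fun x => (expR (- (a x - b x)))%:E).
  exact: integrableS iV.
have irA : P.-integrable A (EFin \o r) by exact: integrableS ir.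
rewrite leeBlDr ?fin_num_measure//.
rewrite -[leLHS]mul1e -(integral_cst _ mA).
apply: (@le_trans _ _ (\int[P]_(x in A) ((expR (- (a x - b x)))%:E + (r x)%:E))).
  apply: le_integral => //; [exact: i1|exact: (integrableD mA iVA irA)|].
  by move=> x _; rewrite -EFinD lee_fin.
rewrite (integralD mA iVA irA) integral_density_ratioV// addeC; apply: leeD.
  apply: (@le_trans _ _ (\int[P]_x (r x)%:E)).
    apply: ge0_subset_integral => //; last by move=> x _; rewrite lee_fin.
    exact: measurable_int ir.
  rewrite -(fineK (integrable_fin_num measurableT ir)).
  by rewrite -[D](fineK fD) -EFinM -EFinD lee_fin.
by apply: le_measure; rewrite ?inE//; exact: measurableI.
Qed.

End LogLikelihoodRatio.

(** * Limits of affine functions *)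

Section Measurability.
Context {R : realType} {d : nat}.

Lemma measurable_inner (tau : 'rV[R]_d) :
  measurable_fun [set: 'rV[R]_d] (inner tau).
Proof.
apply: measurable_sum => i; apply: measurable_funM => //.
apply: (measurability _ (RGenOpens.measurableE R)).
move=> _ [_ [a [b ->] <-]]; rewrite setTI; apply: sub_sigma_algebra.
have /continuousP := @coord_continuous R 1 d ord0 i.
apply; exact: interval_open.
Qed.

Lemma measurable_innerB (tau : 'rV[R]_d) (c : R) :
  measurable_fun [set: 'rV[R]_d] (fun x => inner tau x - c).
Proof. by apply: measurable_funB => //; exact: measurable_inner. Qed.

End Measurability.

Section IntegralCvg.
Context {disp : measure_display} {T : measurableType disp} {R : realType}.
Variables (P : probability T R) (m : nat) (G : T -> 'rV[R]_m).
Hypothesis iG : forall i, P.-integrable [set: T] (fun x => (G x ord0 i)%:E).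

Lemma integrable_innerr (c : 'rV[R]_m) :
  P.-integrable [set: T] (fun x => (inner c (G x))%:E).
Proof.
rewrite (_ : (fun x => _) = (fun x => \sum_(i < m) ((c ord0 i)%:E * (G x ord0 i)%:E))%E).
  by apply: integrable_sum => // i _; exact: integrableZl.
by apply/funext => x; rewrite /inner -sumEFin; under eq_bigr do rewrite EFinM.
Qed.

Lemma Rintegral_innerr (c : 'rV[R]_m) :
  \int[P]_x inner c (G x) = inner c (\row_i \int[P]_x (G x ord0 i)).
Proof.
rewrite /Rintegral.
rewrite (_ : \int[P]_x _ = \int[P]_x \sum_(i < m) ((c ord0 i)%:E * (G x ord0 i)%:E))%E.
  rewrite integral_sum//; last by move=> i; exact: integrableZl.
  rewrite -sum_fine; last first.
    by move=> i _; apply: integrable_fin_num => //; exact: integrableZl.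
  apply: eq_bigr => i _; rewrite mxE integralZl// fineM//.
  exact: integrable_fin_num.
apply: eq_integral => x _.
by rewrite /inner -sumEFin; under eq_bigr do rewrite EFinM.
Qed.

(** Finite dimension replaces dominated convergence: on the points of convergence [b n] may be
    exchanged for convergent coefficients, and the integral is linear in them. *)
Lemma integral_inner_cvg (b : nat -> 'rV[R]_m) (l : T -> R) :
  measurable_fun [set: T] l ->
  {ae P, forall x, inner (b n) (G x) @[n --> \oo] --> l x} ->
  P.-integrable [set: T] (EFin \o l) /\
  \int[P]_x inner (b n) (G x) @[n --> \oo] --> \int[P]_x l x.
Proof.
move=> ml bl.
pose S := [set v | exists2 x, inner (b n) (G x) @[n --> \oo] --> l x & v = G x].
have [] := @pointwise_cvg_coef R m S b (fun v => lim (inner (b n) v @[n --> \oo])).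
  by move=> _ [x xl ->]; apply/cvg_ex; exists (l x).
move=> b' [b0 [b'E b'b0 lE]].
have lb0 : ae_eq P [set: T] (EFin \o l) (fun x => (inner b0 (G x))%:E).
  apply: filterS bl => x xl _ /=.
  by rewrite -lE ?(cvg_lim _ xl)//; exists x.
have mG c : measurable_fun [set: T] (fun x => (inner c (G x))%:E).
  exact: measurable_int (integrable_innerr c).
split.
  apply/integrableP; split; first exact/measurable_EFinP.
  have /integrableP[_] := integrable_innerr b0; congr (_ < _)%E.
  apply: ae_eq_integral => //.
  - exact: measurableT_comp.
  - by apply: measurableT_comp => //; exact/measurable_EFinP.
  - by apply: ae_eq_comp; exact: ae_eq_sym.
have -> : \int[P]_x l x = inner b0 (\row_i \int[P]_x (G x ord0 i)).
  rewrite -Rintegral_innerr; congr fine; apply: ae_eq_integral => //.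
  exact/measurable_EFinP.
rewrite (_ : (fun n => _) = (fun n => inner (b' n) (\row_i \int[P]_x (G x ord0 i)))).
  exact: inner_cvg.
apply/funext => n; rewrite -Rintegral_innerr; congr fine.
apply: ae_eq_integral => //; apply: filterS bl => x xl _.
by rewrite b'E//; exists x.
Qed.

End IntegralCvg.

Section IntegrableDirections.
Context {R : realType} {d : nat} (P : probability 'rV[R]_d R).

Lemma M_lin (a : R) (s t : 'rV[R]_d) : M P s -> M P t -> M P (a *: s + t).
Proof.
move=> Ms Mt; rewrite /M/=.
rewrite (_ : (fun x => _) = (fun x => a%:E * (inner s x)%:E + (inner t x)%:E)%E).
  by apply: integrableD => //; exact: integrableZl.
by apply/funext => x; rewrite innerDl innerZl EFinD EFinM.
Qed.

Lemma M_affine (t : 'rV[R]_d) (c : R) :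
  P.-integrable [set: 'rV[R]_d] (fun x => (inner t x - c)%:E) <-> M P t.
Proof.
have ic k : P.-integrable [set: 'rV[R]_d] (EFin \o (fun=> k : R)).
  exact: finite_measure_integrable_cst.
split=> [i|Mt]; last first.
  rewrite (_ : (fun x => _) = (fun x => (inner t x)%:E - c%:E)%E)//.
  exact: (integrableB measurableT Mt (ic c)).
rewrite /M/= (_ : (fun x => _) = (fun x => (inner t x - c)%:E + c%:E)%E).
  exact: (integrableD measurableT i (ic c)).
by apply/funext => x; rewrite -EFinD subrK.
Qed.

(** The single coordinates of x need not be integrable, so the functions are first expanded along a
    finite spanning family of [M P]. *)
Lemma integral_affine_cvg (tau : nat -> 'rV[R]_d) (c : nat -> R)
    (l : 'rV[R]_d -> R) :
  (forall n, M P (tau n)) -> measurable_fun [set: 'rV[R]_d] l ->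
  {ae P, forall x, inner (tau n) x - c n @[n --> \oo] --> l x} ->
  P.-integrable [set: 'rV[R]_d] (EFin \o l) /\
  \int[P]_x (inner (tau n) x - c n) @[n --> \oo] --> \int[P]_x l x.
Proof.
move=> Mtau ml taul.
have [k [E [ME spanE]]] := max_rank_rows (M P).
pose y n := tau n *m pinvmx E.
(* The final entry 1 turns the additive constant into one more linear coefficient. *)
pose G x := row_mx (\row_i inner (row i E) x) (1%:M : 'rV[R]_1).
pose b n := row_mx (y n) ((- c n)%:M : 'rV[R]_1).
have bG n x : inner (b n) (G x) = inner (tau n) x - c n.
  rewrite /inner big_split_ord big_ord1 /= !row_mxEr !mxE eqxx mulr1n mulr1.
  congr (_ - _).
  have -> : tau n = \sum_i y n ord0 i *: row i E.
    by rewrite -mulmx_sum_row /y mulmxKpV//; exact/spanE.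
  rewrite -[RHS]/(inner _ _) inner_suml; apply: eq_bigr => i _.
  by rewrite !row_mxEl !mxE innerZl.
under eq_fun do under eq_Rintegral do rewrite -bG.
apply: integral_inner_cvg => //.
- move=> i; have [j ->|j ->] := split_ordP i.
    under eq_fun do rewrite row_mxEl mxE; exact: ME.
  under eq_fun do rewrite row_mxEr mxE; exact: finite_measure_integrable_cst.
- apply: filterS taul => x; under eq_fun do rewrite -bG; exact.
Qed.

End IntegrableDirections.

Section AlmostEverywhereLimits.
Context {disp : measure_display} {T : measurableType disp} {R : realType}.
Variable mu : {finite_measure set T -> \bar R}.

Lemma dominates_ae (P : probability T R) (A : T -> Prop) :
  P `<< mu -> {ae mu, forall x, A x} -> {ae P, forall x, A x}.
Proof.
move=> /null_content_dominatesP Pmu [N [mN N0 AN]].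
by exists N; split=> //; exact: Pmu.
Qed.

Lemma ae_density_gt0 (P : probability T R) (p : T -> R) :
  measurable_fun [set: T] p -> (forall x, 0 <= p x) -> has_density P mu p ->
  {ae P, forall x, 0 < p x}.
Proof.
move=> mp p0 Pp; pose N := [set x | p x <= 0].
have mN : measurable N.
  by rewrite -[N]setTI; exact: (measurable_fun_le measurableT mp).
exists N; split=> //; last by move=> x /negP; rewrite -leNgt.
rewrite /= Pp//; apply: integral0_eq => x Nx.
by congr EFin; apply/eqP; rewrite eq_le p0 andbT.
Qed.

(** Passing from [mu] to [P] discards the zeros of [p], and elsewhere ln is continuous. *)
Lemma ae_cvg_ln_density (P : probability T R) (Q : nat -> probability T R)
    (p : T -> R) (b : nat -> T -> R) :
  measurable_fun [set: T] p -> (forall x, 0 <= p x) ->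
  (forall n, measurable_fun [set: T] (b n)) ->
  has_density P mu p -> (forall n, has_density (Q n) mu (fun x => expR (b n x))) ->
  (forall n, (tv_dist P (Q n) <= (1 / (2 ^ n.+1)%:R)%:E)%E) ->
  {ae P, forall x, 0 < p x /\ b n x @[n --> \oo] --> ln (p x)}.
Proof.
move=> mp p0 mb Pp Qb tvPQ.
have mexp n : measurable_fun [set: T] (fun x => expR (b n x)).
  exact: (measurableT_comp (@measurable_expR R)).
have := ae_cvg_of_tv mp mexp p0 (fun n x => expR_ge0 _) Pp Qb tvPQ.
move=> /(dominates_ae (density_dominates mp Pp)).
apply: filterS2 (ae_density_gt0 mp p0 Pp) => x px bp; split=> //.
rewrite (_ : (fun n => b n x) = (fun n => ln (expR (b n x)))).
  by apply: continuous_cvg bp; exact: continuous_ln.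
by apply/funext => n; rewrite expRK.
Qed.

End AlmostEverywhereLimits.

(** * Finiteness of the divergence and the directions in [M P] *)

Section DivergenceFiniteness.
Context {R : realType} {d : nat}.
Variables (mu : {finite_measure set 'rV[R]_d -> \bar R}) (P : probability 'rV[R]_d R).
Variables (K : set 'rV[R]_d) (theta : 'rV[R]_d) (c : R).
Hypothesis mK : measurable K.
Hypothesis Pp : has_density P mu (fun x => \1_K x * expR (inner theta x - c)).

Let a x := inner theta x - c.
Let b vartheta x := inner vartheta x - fine (Lambda mu vartheta).
Let ma : measurable_fun [set: 'rV[R]_d] a.
Proof. exact: measurable_innerB. Qed.
Let mb vartheta : measurable_fun [set: 'rV[R]_d] (b vartheta).
Proof. exact: measurable_innerB. Qed.

Let abE vartheta x : a x - b vartheta x =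
  inner (theta - vartheta) x - (c - fine (Lambda mu vartheta)).
Proof. by rewrite /a /b innerBl; lra. Qed.

Lemma translate_MP (vartheta : 'rV[R]_d) :
  translate theta (M P) vartheta <-> M P (theta - vartheta).
Proof.
have MN s : M P s -> M P (- s).
  (* Negation is obtained as -2 s + s, without going through the zero vector. *)
  move=> Ms; have := M_lin (-2) Ms Ms.
  rewrite -[X in _ + X]scale1r -scalerDl (_ : -2 + 1 = -1) ?scaleN1r//; lra.
split=> [[s Ms <-]|Ms]; first by rewrite opprD addrA subrr sub0r; exact: MN.
by exists (vartheta - theta); [rewrite -opprB; exact: MN|rewrite addrC subrK].
Qed.

Let integrable_MP vartheta :
  P.-integrable [set: 'rV[R]_d] (fun x => (a x - b vartheta x)%:E) <->
  M P (theta - vartheta).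
Proof.
rewrite (_ : (fun x => _) = (fun x =>
  (inner (theta - vartheta) x - (c - fine (Lambda mu vartheta)))%:E)).
  exact: M_affine.
by apply/funext => x; rewrite abE.
Qed.

(** The log-likelihood ratio is affine with linear part [theta - vartheta], and constants are
    integrable under a probability. *)
Lemma I_divergence_M (vartheta : 'rV[R]_d) (Q : probability 'rV[R]_d R) :
  is_Q mu vartheta Q -> (I_divergence P Q < +oo)%E -> M P (theta - vartheta).
Proof.
move=> [_ Qb] h; apply/integrable_MP.
exact: (I_divergence_lty mK ma (mb vartheta) Pp Qb h).
Qed.

Section FixedTarget.
Variables (vartheta : 'rV[R]_d) (Q : probability 'rV[R]_d R).
Hypotheses (QQ : is_Q mu vartheta Q) (Mt : M P (theta - vartheta)).

Lemma I_divergence_QE : I_divergence P Q = (\int[P]_x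
  (inner (theta - vartheta) x - (c - fine (Lambda mu vartheta))))%:E.
Proof.
case: QQ => _ Qb; rewrite (I_divergenceE mK ma (mb vartheta) Pp Qb).
have iab : P.-integrable [set: 'rV[R]_d] (fun x => (a x - b vartheta x)%:E).
  exact/integrable_MP.
rewrite -(fineK (integrable_fin_num measurableT iab)); congr EFin.
by rewrite -[LHS]/(Rintegral _ _ _); apply: eq_Rintegral => x _; exact: abE.
Qed.

Lemma I_divergence_Q_fin_num : I_divergence P Q \is a fin_num.
Proof. by rewrite I_divergence_QE. Qed.

Lemma I_divergence_Q_ge0 : (0 <= I_divergence P Q)%E.
Proof.
by case: QQ => _ Qb; apply: (I_divergence_ge0 mK ma (mb vartheta) Pp Qb);
  exact/integrable_MP.
Qed.

Lemma sub_le_I_divergence_Q (e : R) A : 0 < e -> measurable A ->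
  (P A - Q A <= ((4 * e)^-1)%:E * I_divergence P Q + (4 * e)%:E)%E.
Proof.
by case: QQ => _ Qb; apply: (sub_le_I_divergence mK ma (mb vartheta) Pp Qb);
  exact/integrable_MP.
Qed.

End FixedTarget.

Lemma I_divergence_finP (vartheta : 'rV[R]_d) (Q : probability 'rV[R]_d R) :
  is_Q mu vartheta Q ->
  I_divergence P Q \is a fin_num <-> translate theta (M P) vartheta.
Proof.
move=> QQ; rewrite translate_MP; split=> [h|]; last exact: I_divergence_Q_fin_num.
by apply: I_divergence_M QQ _; rewrite ltey_eq h.
Qed.

End DivergenceFiniteness.

(** * Convergence in variation against convergence of the divergence *)

Section Convergence.
Context {R : realType} {d : nat}.
Variables (mu : {finite_measure set 'rV[R]_d -> \bar R}) (P : probability 'rV[R]_d R).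
Variables (K : set 'rV[R]_d) (theta : 'rV[R]_d) (c : R).
Hypothesis mK : measurable K.
Hypothesis Pp : has_density P mu (fun x => \1_K x * expR (inner theta x - c)).
Variables (vartheta : nat -> 'rV[R]_d) (Q : nat -> probability 'rV[R]_d R).
Hypothesis QQ : forall n, is_Q mu (vartheta n) (Q n).

(** By contradiction: among indices with divergence at least [e], a fast converging selection makes
    the log-likelihood ratios tend to 0 [P]-a.e., and then [integral_affine_cvg] sends the
    divergences to 0. *)
Lemma I_divergence_cvg0 :
  tv_dist P (Q n) @[n --> \oo] --> 0%E ->
  (\forall n \near \oo, I_divergence P (Q n) \is a fin_num) ->
  I_divergence P (Q n) @[n --> \oo] --> 0%E.
Proof.
move=> tv0 finD; apply/fine_cvgP; split=> //.
apply/cvgrPdist_lt => e e0; apply: contrapT => bad.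
(* [phi] need not be increasing: only the speed of convergence in [k] matters. *)
have /choice[phi phiP] : forall k, exists n,
    [/\ M P (theta - vartheta n), (tv_dist P (Q n) <= (1 / (2 ^ k.+1)%:R)%:E)%E &
      ~ `|0 - fine (I_divergence P (Q n))| < e].
  move=> k; apply: contrapT => nex; apply: bad.
  apply: filterS2 finD (tv_cvg0_near tv0 k) => n fn tvn.
  apply: contrapT => En; apply: nex; exists n; split=> //.
  by apply/translate_MP; apply/(I_divergence_finP mK Pp (QQ n)).
pose cc n := fine (Lambda mu (vartheta (phi n))).
have lim_ln : {ae P, forall x, 0 < \1_K x * expR (inner theta x - c) /\
    inner (vartheta (phi k)) x - cc k @[k --> \oo] -->
      ln (\1_K x * expR (inner theta x - c))}.
  apply: (@ae_cvg_ln_density _ _ _ mu P (fun k => Q (phi k)) _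
    (fun k x => inner (vartheta (phi k)) x - cc k) _ _ _ Pp).
- apply: measurable_funM; first exact: measurable_indic.
  by apply: (measurableT_comp (@measurable_expR R)); exact: measurable_innerB.
- by move=> x; rewrite mulr_ge0 ?expR_ge0.
- by move=> n; exact: measurable_innerB.
- by move=> n; have [] := QQ (phi n).
- by move=> n; have [] := phiP n.
have [] := @integral_affine_cvg _ _ P (fun n => theta - vartheta (phi n))
  (fun n => c - cc n) (cst 0).
- by move=> n; have [] := phiP n.
- exact: measurable_cst.
- apply: filterS lim_ln => x [px].
  have Kx : K x.
    by apply: contrapT => nK; move: px; rewrite indicE memNset// mul0r ltxx.
  rewrite indicE mem_set// mul1r expRK => /(cvgB (cvg_cst (inner theta x - c))).
  rewrite subrr; apply: cvg_trans; apply: near_eq_cvg; near=> n.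
  by rewrite innerBl !fctE; ring.
move=> _; rewrite (_ : Rintegral _ _ _ = 0); last first.
  by rewrite /Rintegral integral0.
move=> /cvgrPdist_lt/(_ _ e0)[N _ /(_ N (leqnn N))/=].
have [MN _] := phiP N.
by rewrite (I_divergence_QE mK Pp (QQ _) MN).
Unshelve. all: by end_near. Qed.

Lemma tv_dist_cvg0 : I_divergence P (Q n) @[n --> \oo] --> 0%E ->
  tv_dist P (Q n) @[n --> \oo] --> 0%E.
Proof.
move=> /fine_cvgP[Dfin D0].
have tve e : 0 < e -> \forall n \near \oo, (tv_dist P (Q n) <= (16 * e)%:E)%E.
  (* At the level 16 e^2 both terms of [sub_le_I_divergence] equal 4 e; [tv_le] doubles their
     sum. *)
  move=> e0; have e16 : 0 < 16 * e ^+ 2 by rewrite mulr_gt0// exprn_gt0.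
  move/cvgrPdist_le : D0 => /(_ _ e16); apply: filterS2 Dfin => n fn.
  rewrite sub0r normrN => h.
  rewrite (_ : 16 * e = 8 * e + 8 * e); last lra.
  apply: tv_le => A mA.
  have Mn : M P (theta - vartheta n).
    by apply: I_divergence_M (QQ n) _; [exact: mK|exact: Pp|rewrite ltey_eq fn].
  apply: le_trans (sub_le_I_divergence_Q mK Pp (QQ n) Mn e0 mA) _.
  rewrite -(fineK fn) -EFinM -EFinD lee_fin.
  have en0 : e != 0 by rewrite gt_eqF.
  have -> : 8 * e = (4 * e)^-1 * (16 * e ^+ 2) + 4 * e by field.
  rewrite lerD2r ler_wpM2l ?invr_ge0//; first lra.
  exact: le_trans (ler_norm _) h.
apply/fine_cvgP; split.
  apply: filterS (tve 1 ltr01) => n h; rewrite ge0_fin_numE ?tv_ge0//.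
  by rewrite (le_lt_trans h)// ltry.
apply/cvgrPdist_le => e e0.
have e16 : 0 < e / 16 by rewrite divr_gt0.
apply: filterS (tve _ e16) => n h; rewrite sub0r normrN ger0_norm.
  rewrite -lee_fin fineK.
    by apply: le_trans h _; rewrite lee_fin; lra.
  by rewrite ge0_fin_numE ?tv_ge0// (le_lt_trans h)// ltry.
by rewrite fine_ge0// tv_ge0.
Qed.

End Convergence.

(** * Exponential families *)

Section ExponentialMeasures.
Context {R : realType} {d : nat} (mu : {finite_measure set 'rV[R]_d -> \bar R}).
Hypothesis mu_neq0 : mu [set: 'rV[R]_d] <> 0%E.

Let mexp (theta : 'rV[R]_d) (c : R) :
  measurable_fun [set: 'rV[R]_d] (fun x => expR (inner theta x - c)).
Proof.
apply: (measurableT_comp (@measurable_expR R)); exact: measurable_innerB.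
Qed.

(** The integral cannot vanish, the integrand being positive everywhere and [mu] nonzero; so [lne]
    and [fine] reduce to the real logarithm. *)
Lemma dom_Lambda_partition (theta : 'rV[R]_d) : dom_Lambda mu theta ->
  exists2 z, 0 < z & (\int[mu]_x (expR (inner theta x))%:E)%E = z%:E /\
    fine (Lambda mu theta) = ln z.
Proof.
rewrite /dom_Lambda/= /Lambda; set Z := (\int[mu]_x _)%E => ZLy.
have mf : measurable_fun [set: 'rV[R]_d] (fun x => (expR (inner theta x))%:E).
  apply/measurable_EFinP; apply: (measurableT_comp (@measurable_expR R)).
  exact: measurable_inner.
have Z0 : (0 <= Z)%E by apply: integral_ge0 => x _; rewrite lee_fin expR_ge0.
have Zneq0 : Z != 0%E.
  apply/eqP => ZE; apply: mu_neq0.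
  have [+ _] := ae_eq_integral_abs mu measurableT mf.
  under eq_integral do rewrite gee0_abs ?lee_fin ?expR_ge0//.
  move=> /(_ ZE)[N [mN N0 sub]]; apply/eqP; rewrite -measure_le0 -N0.
  rewrite le_measure ?inE// => x _; apply: sub => /(_ I) [] /eqP.
  by rewrite gt_eqF// expR_gt0.
clearbody Z; case: Z Z0 Zneq0 ZLy => [z| |]//; rewrite lee_fin eqe => z0 zn _.
by exists z; [rewrite lt_def zn|rewrite lne_EFin// lt_def zn].
Qed.

Lemma integral_expB (theta : 'rV[R]_d) (c : R) :
  (\int[mu]_x (expR (inner theta x - c))%:E =
   (expR (- c))%:E * \int[mu]_x (expR (inner theta x))%:E)%E.
Proof.
have mf : measurable_fun [set: 'rV[R]_d] (fun x => (expR (inner theta x))%:E).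
  apply/measurable_EFinP; apply: (measurableT_comp (@measurable_expR R)).
  exact: measurable_inner.
have f0 x : [set: 'rV[R]_d] x -> (0 <= (expR (inner theta x))%:E)%E.
  by move=> _; rewrite lee_fin expR_ge0.
rewrite -(ge0_integralZl_EFin mu measurableT f0 mf (expR_ge0 _)).
by apply: eq_integral => x _; rewrite -EFinM -expRD addrC.
Qed.

(** [is_Q] is a predicate, so newly constructed parameters need an actual measure; it is packed from
    the nonnegative charge induced by the density. *)
Lemma exists_Q (theta : 'rV[R]_d) : dom_Lambda mu theta ->
  exists Q : probability 'rV[R]_d R, is_Q mu theta Q.
Proof.
move=> domt; have [z z0 [Zz Lz]] := dom_Lambda_partition domt.
pose f x := expR (inner theta x - ln z).
have f0 x : 0 <= f x by exact: expR_ge0.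
have intf1 : (\int[mu]_x (f x)%:E = 1)%E.
  by rewrite integral_expB Zz expRN lnK ?posrE// -EFinM mulVf// gt_eqF//.
have intf : mu.-integrable [set: 'rV[R]_d] (fun x => (f x)%:E).
  apply/integrableP; split; first by apply/measurable_EFinP; exact: mexp.
  by under eq_integral do rewrite gee0_abs ?lee_fin//; rewrite intf1 ltry.
have fA0 A : (0 <= induced_charge intf A)%E.
  by rewrite /induced_charge integral_ge0// => x _; rewrite lee_fin.
pose nu := measure_of_charge _ fA0.
have nu1 : nu [set: 'rV[R]_d] = 1%E by [].
pose Q : probability 'rV[R]_d R :=
  HB.pack_for (probability 'rV[R]_d R) nu (Measure_isProbability.Build _ _ _ nu nu1).
by exists Q; split=> // A mA; rewrite Lz.
Qed.

(** Lets bounds on [Lambda] be proved by pointwise estimates under the integral. *)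
Lemma Lambda_le (theta : 'rV[R]_d) (c : R) : dom_Lambda mu theta ->
  (\int[mu]_x (expR (inner theta x - c))%:E <= 1)%E -> fine (Lambda mu theta) <= c.
Proof.
move=> /dom_Lambda_partition[z z0 [Zz ->]].
rewrite integral_expB Zz -EFinM lee_fin expRN mulrC ler_pdivrMr ?expR_gt0// mul1r.
by move=> zc; rewrite -ler_expR lnK ?posrE.
Qed.

End ExponentialMeasures.

(** * Convergence, affine hulls and spans in finite dimension *)

Section FiniteDimension.
Context {R : realType} {d : nat}.

Lemma cvg_rV {I : Type} (F : set_system I) {FF : Filter F}
    (x : I -> 'rV[R]_d) (x0 : 'rV[R]_d) :
  (forall i, x t ord0 i @[t --> F] --> x0 ord0 i) -> x t @[t --> F] --> x0.
Proof.
move=> xx0; apply/cvg_ballP => e e0.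
have : \forall t \near F, forall i : 'I_d, ball (x0 ord0 i) e (x t ord0 i).
  by apply: filter_forall => i; have /cvg_ballP := xx0 i; apply.
by apply: filterS => t h; split=> // i j; rewrite ord1.
Qed.

Lemma affine_hull_sub (B : set 'rV[R]_d) k (s : R) (x : 'rV[R]_d)
    (r : 'I_k -> R) (y : 'I_k -> 'rV[R]_d) :
  B x -> (forall j, B (y j)) ->
  affine_hull B (x + s *: \sum_j r j *: (y j - x)).
Proof.
move=> Bx By.
(* The point [x] gets the weight that remains after each [y j] has received [s * r j]. *)
exists (1 + k)%N, (fun i => match fintype.split i with
    inl _ => 1 - s * \sum_j r j | inr j => s * r j end),
  (fun i => match fintype.split i with inl _ => x | inr j => y j end).
split=> [i||]; first by case: (fintype.split i).
- rewrite big_split_ord big_ord1 /= (unsplitK (inl _)).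
  under [X in _ + X]eq_bigr do rewrite (unsplitK (inr _)).
  by rewrite -mulr_sumr subrK.
- rewrite big_split_ord big_ord1 /= (unsplitK (inl _)).
  under [X in _ = _ + X]eq_bigr do rewrite (unsplitK (inr _)) -scalerA.
  rewrite -scaler_sumr; under eq_bigr do rewrite scalerBr.
  rewrite sumrB -scaler_suml scalerBr scalerBl scale1r scalerA.
  by rewrite addrAC addrA.
Qed.

Lemma linear_span_sub (V : set 'rV[R]_d) k (E : 'M[R]_(k, d)) v :
  V 0 -> (forall a s t, V s -> V t -> V (a *: s + t)) ->
  (forall i, V (row i E)) -> (v <= E)%MS -> V v.
Proof.
move=> V0 Vlin VE /submxP[c ->]; rewrite mulmx_sum_row.
by apply: big_ind => // [s t Vs Vt|i _]; [rewrite -[s]scale1r|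
  rewrite -[_ *: _]addr0]; exact: Vlin.
Qed.

(* The correction is a combination of the [w n] themselves: with
   [w n = vartheta n - y0], these are directions in which one may move away from
   a relative interior point [y0] without leaving the convex set. *)
Lemma vanishing_correction (V : set 'rV[R]_d) (w u : nat -> 'rV[R]_d) :
  V 0 -> (forall a s t, V s -> V t -> V (a *: s + t)) ->
  (forall n, V (w n - u n)) -> (forall i, u n ord0 i @[n --> \oo] --> 0) ->
  exists k (f : 'I_k -> nat) (a : nat -> 'rV[R]_k),
    (forall j, a n ord0 j @[n --> \oo] --> 0) /\
    forall n, V (w n - \sum_j a n ord0 j *: w (f j)).
Proof.
move=> V0 Vlin Vwu u0.
have [k [E [VE spanE]]] := max_rank_rows V.
(* Multiplication by [C] is the quotient map modulo [V], under which [w n] and [u n] have the same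
   image. *)
pose C := cokermx E.
have VC v : V v <-> v *m C = 0.
  split=> [Vv|vC]; first by apply/eqP; rewrite -submxE; exact: spanE.
  by apply: (linear_span_sub V0 Vlin VE); rewrite submxE -/C vC.
have wuC n : w n *m C = u n *m C.
  by apply/eqP; rewrite -subr_eq0 -mulmxBl; apply/eqP/VC.
have wC0 i : (w n *m C) ord0 i @[n --> \oo] --> 0.
  have := @pinvmx_inner_cvg R d d C u 0; rewrite mul0mx => h.
  under eq_fun do rewrite wuC.
  by have := h _ i; rewrite mxE; apply => j; rewrite mxE.
(* Finitely many images of the [w n] span them all; since the images tend to 0, so do their
   coordinates [a n]. *)
have [l [X [XS XP]]] := max_rank_rows [set w n *m C | n in [set: nat]].
have /choice[f fE] : forall i, exists n, row i X = w n *m C.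
  by move=> i; have [n _ <-] := XS i; exists n.
pose a n := w n *m C *m pinvmx X.
exists l, f, a; split=> [j|n].
  have := @pinvmx_inner_cvg R _ _ (pinvmx X) (fun n => w n *m C) 0.
  rewrite mul0mx => /(_ _ j); rewrite mxE; apply => i.
  by rewrite mxE; exact: wC0.
apply/VC; rewrite mulmxBl mulmx_suml; apply/eqP; rewrite subr_eq0; apply/eqP.
rewrite -[LHS](@mulmxKpV _ _ _ _ _ X); last by apply: XP; exists n.
rewrite -/(a n) mulmx_sum_row; apply: eq_bigr => j _.
by rewrite -scalemxAl fE.
Qed.

End FiniteDimension.

(** * Limits in variation of exponential families *)

Section VariationLimits.
Context {R : realType} {d : nat}.
Variables (mu : {finite_measure set 'rV[R]_d -> \bar R}) (P : probability 'rV[R]_d R).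
Variables (vartheta : nat -> 'rV[R]_d) (Q : nat -> probability 'rV[R]_d R).
Hypothesis QQ : forall n, is_Q mu (vartheta n) (Q n).
Hypothesis tvPQ : forall n, (tv_dist P (Q n) <= (1 / (2 ^ n.+1)%:R)%:E)%E.

(** Each [Q n] vanishes on [mu]-null sets, so [P] of such a set is below every variation distance,
    hence 0, and Radon-Nikodym applies. *)
Lemma tv_limit_density : exists p : 'rV[R]_d -> R,
  [/\ measurable_fun [set: 'rV[R]_d] p, forall x, 0 <= p x &
      has_density P mu p].
Proof.
have Pmu : P `<< mu.
  apply/null_content_dominatesP => A mA A0.
  have Q0 n : Q n A = 0%E.
    have [_ ->//] := QQ n; apply: null_set_integral => //.
    apply/measurable_funTS/measurable_EFinP.
    by apply: (measurableT_comp (@measurable_expR R)); exact: measurable_innerB.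
  have fP := fin_num_measure P _ mA.
  have PA n : fine (P A) <= 1 / (2 ^ n.+1)%:R.
    rewrite -lee_fin fineK//; apply: le_trans (tvPQ n).
    by apply: le_trans (abse_sub_le_tv P (Q n) mA); rewrite Q0 sube0 lee_abs.
  rewrite -(fineK fP); congr EFin; apply/eqP; rewrite eq_le fine_ge0// andbT.
  apply/ler_addgt0Pl => e e0; rewrite addr0.
  have [n _ /(_ _ (leqnn n))/= ne] : \forall n \near \oo, 1 / (2 ^ n.+1)%:R <= e.
    have : (1 / (2 ^ n.+1)%:R : R) @[n --> \oo] --> 0.
      rewrite (_ : (fun n => _) = geometric (1 / 2) (1 / 2)).
        by apply: cvg_geometric; rewrite ger0_norm; lra.
      by apply/funext => n; rewrite /geometric/= !div1r natrX exprS invfM exprVn.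
    move/cvgrPdist_le/(_ _ e0); apply: filterS => n.
    by rewrite sub0r normrN; apply: le_trans; exact: ler_norm.
  exact: le_trans (PA n) ne.
have ih := Radon_Nikodym_SigmaFinite.f_integrable Pmu.
exists (fun x => fine (Radon_Nikodym_SigmaFinite.f P mu x)); split.
- by apply: measurableT_comp => //; exact: measurable_int ih.
- by move=> x; rewrite fine_ge0//; exact: Radon_Nikodym_SigmaFinite.f_ge0.
- move=> A mA; rewrite (Radon_Nikodym_SigmaFinite.f_integral Pmu mA).
  apply: eq_integral => x _; rewrite fineK//.
  exact: Radon_Nikodym_SigmaFinite.f_fin_num.
Qed.

(* Pointwise limits of affine functions on a set are affine there, so [ln] of
   the density of [P] is affine on the (unspecified) set [K]. *)
Lemma tv_limit_exponential :
  exists (K : set 'rV[R]_d) (theta : 'rV[R]_d) (c : R) (u : nat -> 'rV[R]_d),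
  [/\ measurable K,
      has_density P mu (fun x => \1_K x * expR (inner theta x - c)),
      {ae P, forall x, inner (vartheta n) x - fine (Lambda mu (vartheta n))
         @[n --> \oo] --> inner theta x - c},
      forall i, u n ord0 i @[n --> \oo] --> theta ord0 i &
      forall n, M P (vartheta n - u n)].
Proof.
have [p [mp p0 Pp]] := tv_limit_density.
pose c n := fine (Lambda mu (vartheta n)).
have lnp : {ae P, forall x, 0 < p x /\
    inner (vartheta n) x - c n @[n --> \oo] --> ln (p x)}.
  apply: (ae_cvg_ln_density mp p0 _ Pp _ tvPQ) => n; last by have [] := QQ n.
  exact: measurable_innerB.
pose good x := inner (vartheta n) x - c n @[n --> \oo] --> ln (p x).
(* An appended coordinate 1 makes affine functions linear. *)
pose g (x : 'rV[R]_d) := row_mx x (1%:M : 'rV[R]_1).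
pose b n := row_mx (vartheta n) ((- c n)%:M : 'rV[R]_1).
have gE (v : 'rV[R]_(d + 1)) x :
    inner v (g x) = inner (lsubmx v) x - (- rsubmx v ord0 ord0).
  rewrite opprK /inner big_split_ord big_ord1 /=; congr (_ + _).
    by apply: eq_bigr => i _; rewrite row_mxEl mxE.
  by rewrite row_mxEr !mxE eqxx mulr1n mulr1.
have bg n x : inner (b n) (g x) = inner (vartheta n) x - c n.
  by rewrite gE row_mxKl row_mxKr !mxE eqxx mulr1n opprK.
have [] := @pointwise_cvg_coef R _ (g @` good) b
  (fun v => lim (inner (b n) v @[n --> \oo])).
  move=> _ [x gx <-]; under eq_fun do rewrite bg.
  by apply/cvg_ex; exists (ln (p x)).
move=> b' [b0 [b'E b'b0 limE]].
pose theta := lsubmx b0; pose c0 := - rsubmx b0 ord0 ord0.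
have goodE x : good x -> ln (p x) = inner theta x - c0.
  move=> gx; rewrite -gE -limE; last by exists x.
  by under eq_fun do rewrite bg; rewrite (cvg_lim _ gx).
pose h x := expR (inner theta x - c0).
have mh : measurable_fun [set: 'rV[R]_d] h.
  by apply: (measurableT_comp (@measurable_expR R)); exact: measurable_innerB.
(* [K] stands in for [good]: it has full [P]-measure, and it is visibly Borel because [p] and [h]
   are measurable. *)
pose K := [set x | p x = h x].
have mK : measurable K.
  have -> : K = [set x | p x <= h x] `&` [set x | h x <= p x].
    apply/seteqP; split=> [x /= ->//|x [/= ph hp]].
    by apply/eqP; rewrite eq_le ph.
  apply: measurableI; rewrite -[X in measurable X]setTI;
    exact: measurable_fun_le.
have aeK : {ae P, forall x, K x}.
  apply: filterS lnp => x [px gx].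
  by rewrite /K/= /h -(goodE _ gx) lnK ?posrE.
have PKC : P (~` K) = 0%E.
  by have [N [mN N0 KN]] := aeK; apply: subset_measure0 N0 => //; exact: measurableC.
exists K, theta, c0, (fun n => lsubmx (b' n)); split=> //.
- move=> A mA; have mAK : measurable (A `&` K) by exact: measurableI.
  transitivity (P (A `&` K)).
    have mKC := measurableC mK; have mAKC := measurableI _ _ mA mKC.
    rewrite -{1}(setIT A) -(setUv K) setIUr measureU//; last first.
      by rewrite setIACA setICr setI0.
    by rewrite (subset_measure0 mAKC mKC (@subIsetr _ _ _) PKC) adde0.
  rewrite Pp// integral_mkcondr; apply: eq_integral => x _.
  rewrite patchE indicE; case: ifPn => xK; last by rewrite mul0r.
  by rewrite mul1r; congr EFin; move/set_mem: xK.
- by apply: filterS lnp => x [_ gx]; rewrite -(goodE _ gx).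
- by move=> i; rewrite mxE; under eq_fun do rewrite mxE; exact: b'b0.
(* [b n] and [b' n] agree on the good points, so their difference is an affine function that
   vanishes [P]-a.e. and is therefore integrable. *)
- move=> n; pose k := c n - (- rsubmx (b' n) ord0 ord0).
  apply/(M_affine _ _ k).
  have mf : measurable_fun [set: 'rV[R]_d]
      (fun x => (inner (vartheta n - lsubmx (b' n)) x - k)%:E).
    by apply/measurable_EFinP; exact: measurable_innerB.
  apply/integrableP; split=> //.
  rewrite (@ae_eq_integral _ _ _ P _ (cst 0%E)) ?integral0//.
  + exact: measurableT_comp.
  + apply: filterS lnp => x [_ gx] _ /=.
    have := b'E n (g x) (ex_intro2 _ _ x gx erefl).
    rewrite bg gE innerBl /k => e.
    by rewrite (_ : _ - _ = 0) ?normr0//; lra.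
Qed.

End VariationLimits.

(** * Relative interior points and uniform bounds on the partition function *)

Section RelativeInterior.
Context {R : realType} {d : nat}.
Variables (mu : {finite_measure set 'rV[R]_d -> \bar R}).
Variables (Xi : set 'rV[R]_d) (y0 : 'rV[R]_d).
Hypothesis riy0 : ri Xi y0.

(** Stated for a general filter because it serves both for sequences and for steps tending to 0 from
    the right. *)
Lemma ri_near {I : Type} (F : set_system I) {FF : Filter F} (u : I -> 'rV[R]_d) :
  (forall i, u t ord0 i @[t --> F] --> y0 ord0 i) ->
  (forall t, affine_hull Xi (u t)) -> \forall t \near F, Xi (u t).
Proof.
move=> /cvg_rV uy0 hullu; have [_ nXi] := riy0.
by have := uy0 _ nXi; rewrite /nbhs/=; apply: filterS => t; apply.
Qed.

Lemma ri_segment (y : 'rV[R]_d) : Xi y ->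
  \forall e \near 0^'+, Xi (y0 + e *: (y - y0)) /\ Xi (y0 - e *: (y - y0)).
Proof.
move=> Xiy; have [Xiy0 _] := riy0.
have hull s : affine_hull Xi (y0 + s *: (y - y0)).
  have := @affine_hull_sub _ _ Xi 1 s y0 (fun=> 1) (fun=> y) Xiy0 (fun=> Xiy).
  by rewrite big_ord1 scale1r.
have e0 : e @[e --> (0:R)^'+] --> (0:R) by apply: cvg_at_right_filter; exact: cvg_id.
have near_s (s : R -> R) : s e @[e --> 0^'+] --> 0 ->
    \forall e \near 0^'+, Xi (y0 + s e *: (y - y0)).
  move=> s0; apply: ri_near => [i|e]; last exact: hull.
  under eq_fun do rewrite mxE [X in _ + X]mxE.
  have sy : s e * (y - y0) ord0 i @[e --> 0^'+] --> 0 * (y - y0) ord0 i.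
    by apply: cvgM => //; exact: cvg_cst.
  rewrite mul0r in sy.
  have : y0 ord0 i + s e * (y - y0) ord0 i @[e --> 0^'+] --> y0 ord0 i + 0.
    by apply: cvgD => //; exact: cvg_cst.
  by rewrite addr0.
have e0N : - e @[e --> (0:R)^'+] --> (0:R).
  by rewrite -[X in _ --> X]oppr0; exact: cvgN.
apply: filterS2 (near_s id e0) (near_s -%R e0N) => e Xe.
by rewrite scaleNr => ?; split.
Qed.

Lemma sum_le_max k (r z : 'I_k -> R) (e : R) : \sum_j `|r j| <= e ->
  \sum_j r j * z j <= 0 \/ exists i, \sum_j r j * z j <= e * `|z i|.
Proof.
(* The left alternative covers the empty sum, where no index maximises |z i|. *)
case: k r z => [r z _|k r z re]; first by left; rewrite big_ord0.
right; have [i _ zi] := @arg_maxP _ _ 'I_k.+1 ord0 xpredT (fun i => `|z i|) isT.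
exists i; apply: (@le_trans _ _ (\sum_j `|r j| * `|z i|)).
  apply: ler_sum => j _; apply: le_trans (ler_norm _) _.
  by rewrite normrM ler_wpM2l//; exact: zi.
by rewrite -mulr_suml ler_wpM2r.
Qed.

Hypothesis domXi : Xi `<=` dom_Lambda mu.
Hypothesis mu_neq0 : mu [set: 'rV[R]_d] <> 0%E.

Let mexp (t : 'rV[R]_d) :
  measurable_fun [set: 'rV[R]_d] (fun x => expR (inner t x)).
Proof. by apply: (measurableT_comp (@measurable_expR R)); exact: measurable_inner. Qed.

Lemma integrable_exp_dom (t : 'rV[R]_d) : dom_Lambda mu t ->
  mu.-integrable [set: 'rV[R]_d] (fun x => (expR (inner t x))%:E).
Proof.
move=> /(dom_Lambda_partition mu_neq0)[z _ [Zz _]].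
apply/integrableP; split; first exact/measurable_EFinP.
by under eq_integral do rewrite gee0_abs ?lee_fin ?expR_ge0//; rewrite Zz ltry.
Qed.

(* An exponential whose parameter is close to [y0] is dominated by the finitely
   many exponentials at the points [y0 +- e *: (y j - y0)] of [Xi]. *)
Lemma ri_bounded_partition k (y : 'I_k -> 'rV[R]_d) : (forall j, Xi (y j)) ->
  exists2 e, 0 < e & exists C, forall r : 'I_k -> R, \sum_j `|r j| <= e ->
    (\int[mu]_x (expR (inner (y0 + \sum_j r j *: (y j - y0)) x - C))%:E <= 1)%E.
Proof.
move=> Xiy; have [Xiy0 _] := riy0.
have : \forall e \near (0:R)^'+, forall j,
    Xi (y0 + e *: (y j - y0)) /\ Xi (y0 - e *: (y j - y0)).
  by apply: filter_forall => j; exact: ri_segment.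
move=> /(filterI (nbhs_right_gt (0:R)))/filter_ex[e [/= e0 Xie]].
exists e => //.
pose h x := expR (inner y0 x) + \sum_j (expR (inner (y0 + e *: (y j - y0)) x)
  + expR (inner (y0 - e *: (y j - y0)) x)).
have ih : mu.-integrable [set: 'rV[R]_d] (EFin \o h).
  rewrite (_ : EFin \o h = (fun x => (expR (inner y0 x))%:E +
    \sum_j ((expR (inner (y0 + e *: (y j - y0)) x))%:E
      + (expR (inner (y0 - e *: (y j - y0)) x))%:E))%E).
    apply: integrableD => //; first exact/integrable_exp_dom/domXi.
    apply: integrable_sum => // j _; have [Xp Xm] := Xie j.
    by apply: integrableD => //; exact/integrable_exp_dom/domXi.
  by apply/funext => x; rewrite /h/= EFinD -sumEFin.
have mh : measurable_fun [set: 'rV[R]_d] (EFin \o h) by exact: measurable_int ih.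
have h0 x : 0 <= h x.
  by rewrite addr_ge0 ?expR_ge0// sumr_ge0// => j _; rewrite addr_ge0 ?expR_ge0.
pose C := \int[mu]_x h x.
have hE : (\int[mu]_x (h x)%:E = C%:E)%E by rewrite fineK//; exact: integrable_fin_num ih.
exists C => r re.
set t := y0 + _.
(* The exponent exceeds that of [y0] by at most e |v|, with v the largest of the values at the
   directions, and e^(u + e |v|) <= e^(u + e v) + e^(u - e v). *)
have th x : expR (inner t x) <= h x.
  rewrite /t innerDl inner_suml.
  under eq_bigr do rewrite innerZl.
  have [rz0|[i rz]] := sum_le_max (fun j => inner (y j - y0) x) re.
    apply: (@le_trans _ _ (expR (inner y0 x))); first by rewrite ler_expR gerDl.
    by rewrite lerDl sumr_ge0// => j _; rewrite addr_ge0 ?expR_ge0.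
  apply: (@le_trans _ _ (expR (inner (y0 + e *: (y i - y0)) x)
    + expR (inner (y0 - e *: (y i - y0)) x))).
    apply: (@le_trans _ _ (expR (inner y0 x + e * `|inner (y i - y0) x|))).
      by rewrite ler_expR lerD2l.
    rewrite (innerBl y0) (innerDl y0 (e *: _)) !innerZl.
    have [z0|z0] := ger0P (inner (y i - y0) x).
      by rewrite lerDl expR_ge0.
    by rewrite mulrN lerDr expR_ge0.
  by rewrite /h (bigD1 i)//= addrCA lerDl addr_ge0 ?expR_ge0// sumr_ge0.
rewrite integral_expB.
apply: (@le_trans _ _ ((expR (- C))%:E * C%:E)%E).
  rewrite lee_wpmul2l ?lee_fin ?expR_ge0// -hE.
  apply: ge0_le_integral => //.
  - exact/measurable_EFinP.
  - by move=> x _; rewrite lee_fin.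
(* The integral of [h] itself serves as the bound [C], since C <= 1 + C <= e^C. *)
rewrite -EFinM lee_fin expRN mulrC ler_pdivrMr ?expR_gt0// mul1r.
by apply: le_trans (expR_ge1Dx C); rewrite lerDr.
Qed.

End RelativeInterior.

(** The graph lies above its tangent at [m], and the linear terms cancel in the weighted mean. *)
Lemma expR_convex {R : realType} (t u v : R) : 0 <= t <= 1 ->
  expR ((1 - t) * u + t * v) <= (1 - t) * expR u + t * expR v.
Proof.
move=> /andP[t0 t1]; set m := _ + _.
have uE : expR u = expR m * expR (u - m) by rewrite -expRD addrC subrK.
have vE : expR v = expR m * expR (v - m) by rewrite -expRD addrC subrK.
have hu := expR_ge1Dx (u - m); have hv := expR_ge1Dx (v - m).
have m0 := expR_gt0 m.
rewrite uE vE !(mulrCA _ (expR m)) -mulrDr ler_peMr ?expR_ge0//.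
have h1 : (1 - t) * (1 + (u - m)) <= (1 - t) * expR (u - m).
  by rewrite ler_wpM2l// subr_ge0.
have h2 : t * (1 + (v - m)) <= t * expR (v - m) by rewrite ler_wpM2l.
apply: le_trans (lerD h1 h2); rewrite /m; nra.
Qed.

(** * Approximation within a convex parameter set *)

Section ConvexFamily.
Context {R : realType} {d : nat}.
Variables (mu : {finite_measure set 'rV[R]_d -> \bar R}) (Xi : set 'rV[R]_d).
Hypothesis mu_neq0 : mu [set: 'rV[R]_d] <> 0%E.
Hypothesis domXi : Xi `<=` dom_Lambda mu.
Hypothesis cvxXi : convex_set (M := 'rV[R]_d) Xi.

Lemma convex_comb (x y : 'rV[R]_d) (t : R) : Xi x -> Xi y -> 0 <= t <= 1 ->
  Xi ((1 - t) *: x + t *: y).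
Proof.
move=> Xx Xy /andP[t0 t1].
have t01 : Itv.spec (@Itv.num_sem R) (Itv.Real `[0%Z, 1%Z]) t.
  by apply/and3P; split; [rewrite num_real|rewrite bnd_simp|rewrite bnd_simp].
have := @cvxXi y x (Itv.mk t01) (mem_set Xy) (mem_set Xx).
by move=> /set_mem; rewrite /conv/= addrC.
Qed.

Variables (P : probability 'rV[R]_d R).
Variables (vartheta : nat -> 'rV[R]_d) (Q : nat -> probability 'rV[R]_d R).
Hypothesis Xivartheta : forall n, Xi (vartheta n).
Hypothesis QQ : forall n, is_Q mu (vartheta n) (Q n).
Hypothesis tvPQ : forall n, (tv_dist P (Q n) <= (1 / (2 ^ n.+1)%:R)%:E)%E.
Variables (y0 : 'rV[R]_d) (Q0 : probability 'rV[R]_d R).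
Hypothesis riy0 : ri Xi y0.
Hypothesis QQ0 : is_Q mu y0 Q0.
Hypothesis DQ0 : (I_divergence P Q0 < +oo)%E.

(** [C] takes the place of the value at [y]: it will be uniform over a varying sequence of points
    [y]. Convexity of the exponential is applied under the integral. *)
Lemma Lambda_convex_le (x y : 'rV[R]_d) (t C : R) : 0 <= t <= 1 ->
  Xi x -> dom_Lambda mu ((1 - t) *: x + t *: y) ->
  (\int[mu]_z (expR (inner y z - C))%:E <= 1)%E ->
  fine (Lambda mu ((1 - t) *: x + t *: y)) <=
    (1 - t) * fine (Lambda mu x) + t * C.
Proof.
move=> t01 Xix dom intC; have /andP[t0 t1] := t01; apply: Lambda_le => //.
set c := fine _.
have mexp s k : measurable_fun [set: 'rV[R]_d] (fun z => (expR (inner s z - k))%:E).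
  apply/measurable_EFinP; apply: (measurableT_comp (@measurable_expR R)).
  exact: measurable_innerB.
have e0 s k z : (0 <= (expR (inner s z - k))%:E)%E by rewrite lee_fin expR_ge0.
have mexpZ r s k : measurable_fun [set: 'rV[R]_d]
    (fun z => (r%:E * (expR (inner s z - k))%:E)%E).
  by apply: emeasurable_funM => //; exact: mexp.
have intx : (\int[mu]_z (expR (inner x z - c))%:E = 1)%E.
  have [w w0 [ww wc]] := dom_Lambda_partition mu_neq0 (domXi Xix).
  by rewrite integral_expB ww /c wc expRN lnK ?posrE// -EFinM mulVf// gt_eqF.
apply: (@le_trans _ _ (\int[mu]_z ((1 - t)%:E * (expR (inner x z - c))%:E
    + t%:E * (expR (inner y z - C))%:E))%E).
  apply: ge0_le_integral => //.
  - by apply: emeasurable_funD.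
  - move=> z _; rewrite -!EFinM -EFinD lee_fin.
    apply: le_trans (expR_convex _ _ t01); rewrite ler_expR innerDl !innerZl; lra.
rewrite ge0_integralD//; last 2 first.
- by move=> z _; rewrite mule_ge0// lee_fin subr_ge0.
- by move=> z _; rewrite mule_ge0// lee_fin.
rewrite !ge0_integralZl_EFin//; last by rewrite subr_ge0.
rewrite intx mule1.
apply: (@le_trans _ _ ((1 - t)%:E + t%:E * 1%:E)%E).
  by rewrite leeD2l// lee_wpmul2l ?lee_fin.
by rewrite -EFinM -EFinD lee_fin; lra.
Qed.

(** [J] is chosen before [t], so that letting [t] tend to 0 makes the divergence vanish. *)
Lemma convex_approximation : exists J, forall t, 0 < t < 1 ->
  exists Q', [/\ expfam mu Xi Q', (0 <= I_divergence P Q')%E &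
    (I_divergence P Q' <= (t * J)%:E)%E].
Proof.
have [K [theta [c [u [mK Pp aelim utheta Mu]]]]] := tv_limit_exponential QQ tvPQ.
have My0 := I_divergence_M mK Pp QQ0 DQ0.
have M0 : M P 0 by apply/(M_affine _ _ 0); under eq_fun do
  rewrite (_ : inner 0 _ = 0) ?subr0 ?innerE ?mul0mx ?mxE//; exact: integrable0.
pose w n := vartheta n - y0.
have [k [f [a [a0 Mwa]]]] : exists k (f : 'I_k -> nat) (a : nat -> 'rV[R]_k),
    (forall j, a n ord0 j @[n --> \oo] --> 0) /\
    forall n, M P (w n - \sum_j a n ord0 j *: w (f j)).
  apply: (vanishing_correction (u := fun n => u n - theta)) => //.
  - by move=> r s s'; exact: M_lin.
  - move=> n; have := M_lin 1 (Mu n) My0; rewrite scale1r.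
    by congr (M P _); apply/rowP => i; rewrite !mxE; ring.
  - move=> i.
    have : u n ord0 i - theta ord0 i @[n --> \oo] --> theta ord0 i - theta ord0 i.
      by apply: cvgB => //; exact: cvg_cst.
    by rewrite subrr; apply: cvg_trans; apply: near_eq_cvg; near=> n; rewrite !mxE.
have [e e0 [C intC]] := ri_bounded_partition riy0 domXi mu_neq0
  (fun j => Xivartheta (f j)).
(* The majorants of the log-likelihood ratios will converge to [t * l]; the added 1 in [J] leaves a
   slack of [t] for selecting an index. *)
pose l x := inner (theta - y0) x - (c - C).
pose J := \int[P]_x l x + 1; exists J => t /andP[t0 t1].
have t01 : 0 <= t <= 1 by rewrite !ltW.
(* Chosen so that t s = -(1 - t): the shift of [y n] then cancels the part of (1 - t) w_n that lies
   outside [M P]. *)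
pose s := - ((1 - t) / t).
pose y n := y0 + s *: \sum_j a n ord0 j *: w (f j).
have sa0 j : s * a n ord0 j @[n --> \oo] --> 0.
  have : s * a n ord0 j @[n --> \oo] --> s * 0 by apply: cvgM => //; exact: cvg_cst.
  by rewrite mulr0.
have yE n : y n = y0 + \sum_j (s * a n ord0 j) *: w (f j).
  by rewrite /y scaler_sumr; under eq_bigr do rewrite scalerA.
have yy0 i : y n ord0 i @[n --> \oo] --> y0 ord0 i.
  have : y0 ord0 i + \sum_j (s * a n ord0 j) * w (f j) ord0 i @[n --> \oo] -->
      y0 ord0 i + \sum_(j < k) 0.
    apply: cvgD; first exact: cvg_cst.
    apply: cvg_big; first exact: add_continuous.
    move=> j _; rewrite -[X in _ --> X](mul0r (w (f j) ord0 i)).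
    by apply: cvgM => //; exact: cvg_cst.
  rewrite big1// addr0; apply: cvg_trans; apply: near_eq_cvg; near=> n.
  by rewrite yE mxE summxE; congr (_ + _); apply: eq_bigr => j _; rewrite [RHS]mxE.
have Xiy0 : Xi y0 by case: riy0.
have nearXi : \forall n \near \oo, Xi (y n).
  by apply: (ri_near riy0 yy0) => n; apply: affine_hull_sub.
have nearC : \forall n \near \oo, \sum_j `|s * a n ord0 j| <= e.
  have : \sum_j `|s * a n ord0 j| @[n --> \oo] --> \sum_(j < k) `|0 : R|.
    apply: cvg_big; first exact: add_continuous.
    by move=> j _; apply: cvg_norm.
  rewrite normr0 big1// => /cvgrPdist_le/(_ _ e0); apply: filterS => n.
  by rewrite sub0r normrN; apply: le_trans; exact: ler_norm.
pose z n := (1 - t) *: vartheta n + t *: y n.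
(* [Lambda] at [z n] is replaced by its convex upper bound, which converges once combined with the
   linear terms. *)
pose cz n := c - ((1 - t) * fine (Lambda mu (vartheta n)) + t * C).
have Mz n : M P (theta - z n).
  have -> : theta - z n =
      (- (1 - t)) *: (w n - \sum_j a n ord0 j *: w (f j)) + (theta - y0).
    have tyE : t *: y n = t *: y0 - (1 - t) *: \sum_j a n ord0 j *: w (f j).
      by rewrite /y scalerDr scalerA /s mulrN mulrCA divff ?gt_eqF// mulr1 scaleNr.
    rewrite /z tyE /w; set S := \sum_j _; apply/rowP => i; rewrite !mxE; ring.
  exact: M_lin.
have Xiz : \forall n \near \oo, Xi (z n).
  by apply: filterS nearXi => n Xiyn; apply: convex_comb.
have [_ intcvg] : P.-integrable [set: 'rV[R]_d] (EFin \o (fun x => t * l x)) /\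
    \int[P]_x (inner (theta - z n) x - cz n) @[n --> \oo] --> \int[P]_x (t * l x).
  apply: integral_affine_cvg => //.
    by apply: measurable_funM => //; exact: measurable_innerB.
  apply: filterS aelim => x xlim.
  have ylim : inner (y n) x @[n --> \oo] --> inner y0 x by exact: inner_cvg.
  have : (inner theta x - c)
      - (1 - t) * (inner (vartheta n) x - fine (Lambda mu (vartheta n)))
      - t * inner (y n) x + t * C @[n --> \oo] -->
      (inner theta x - c) - (1 - t) * (inner theta x - c) - t * inner y0 x + t * C.
    apply: cvgD; last exact: cvg_cst.
    apply: cvgB; last by apply: cvgM => //; exact: cvg_cst.
    apply: cvgB; first exact: cvg_cst.
    by apply: cvgM => //; exact: cvg_cst.
  rewrite (_ : _ + t * C = t * l x); last by rewrite /l innerBl; ring.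
  apply: cvg_trans; apply: near_eq_cvg; near=> n.
  by rewrite (innerBl theta) (innerDl ((1 - t) *: _)) !innerZl /cz; ring.
have il : P.-integrable [set: 'rV[R]_d] (EFin \o l) by apply/M_affine.
rewrite RintegralZl// in intcvg.
have lt_tJ : \forall n \near \oo,
    \int[P]_x (inner (theta - z n) x - cz n) <= t * J.
  move/cvgrPdist_le : intcvg => /(_ _ t0); apply: filterS => n.
  by rewrite ler_distlC => /andP[_]; rewrite /J mulrDr mulr1.
have [n [Xizn Cn Jn]] : exists n, [/\ Xi (z n),
    \sum_j `|s * a n ord0 j| <= e &
    \int[P]_x (inner (theta - z n) x - cz n) <= t * J].
  by apply: (@filter_ex _ \oo); apply: filterS3 Xiz nearC lt_tJ => n.
have [Q' QQ'] := exists_Q mu_neq0 (domXi Xizn).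
exists Q'; split; first by exists (z n).
  by have := I_divergence_Q_ge0 mK Pp QQ' (Mz n).
rewrite (I_divergence_QE mK Pp QQ' (Mz n)) lee_fin; apply: le_trans Jn.
apply: le_Rintegral => //; [exact/M_affine|exact/M_affine|] => x _.
rewrite lerD2l lerN2 lerD2l lerN2.
apply: Lambda_convex_le => //; first exact: domXi.
by have := intC _ Cn; rewrite yE.
Unshelve. all: by end_near. Qed.

End ConvexFamily.

(** * Measures on faces and the closure statements *)

Lemma is_QF_density {R : realType} {d : nat}
    (mu : {finite_measure set 'rV[R]_d -> \bar R}) (F : set 'rV[R]_d)
    (theta : 'rV[R]_d) (P : probability 'rV[R]_d R) :
  is_QF mu F theta P -> has_density P mu (fun x => \1_(closure F) x *
    expR (inner theta x - fine (Lambda (mu_cl mu F) theta))).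
Proof.
move=> [_ QF]; apply: has_density_mrestr QF => [|x]; last exact: expR_ge0.
by apply: (measurableT_comp (@measurable_expR R)); exact: measurable_innerB.
Qed.

Lemma expfam_choice {R : realType} {d : nat}
    (mu : {finite_measure set 'rV[R]_d -> \bar R}) (Xi : set 'rV[R]_d)
    (Q : nat -> probability 'rV[R]_d R) : (forall n, expfam mu Xi (Q n)) ->
  exists vartheta, (forall n, Xi (vartheta n)) /\ forall n, is_Q mu (vartheta n) (Q n).
Proof.
move=> QXi; have /choice[vartheta h] : forall n, exists t, Xi t /\ is_Q mu t (Q n).
  by move=> n; have [t] := QXi n; exists t.
by exists vartheta; split=> n; have [] := h n.
Qed.

Theorem theorem3 (R : realType) (d : nat)
    (mu : {finite_measure set 'rV[R]_d -> \bar R})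
    (mu_neq0 : mu [set: 'rV[R]_d] <> 0%E) :
  [/\ (* (i) *)
      forall (vartheta : nat -> 'rV[R]_d) (Q : nat -> probability 'rV[R]_d R)
        (F : set 'rV[R]_d) (theta : 'rV[R]_d) (P : probability 'rV[R]_d R),
        (forall n, Theta mu (vartheta n)) ->
        (forall n, is_Q mu (vartheta n) (Q n)) ->
        is_face (convex_core mu) F -> Theta_F mu F theta -> is_QF mu F theta P ->
        tv_dist P (Q n) @[n --> \oo] --> 0%E ->
        ((\forall n \near \oo, I_divergence P (Q n) \is a fin_num) ->
          I_divergence P (Q n) @[n --> \oo] --> 0%E) /\
        ((\forall n \near \oo, I_divergence P (Q n) \is a fin_num) <->
          (\forall n \near \oo, translate theta (M P) (vartheta n))),
      (* (ii) *)
      forall (Xi F : set 'rV[R]_d) (theta : 'rV[R]_d)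
        (P : probability 'rV[R]_d R),
        Xi `<=` Theta mu ->
        is_face (convex_core mu) F -> Theta_F mu F theta -> is_QF mu F theta P ->
        cl_rI (expfam mu Xi) P <->
        cl_v (expfam mu (Xi `&` translate theta (M P))) P
    & (* (iii) *)
      forall Xi : set 'rV[R]_d,
        Xi `<=` Theta mu -> convex_set (M := 'rV[R]_d) Xi ->
        forall P : probability 'rV[R]_d R,
          cl_v (expfam mu Xi) P ->
          (exists2 Q : probability 'rV[R]_d R,
             expfam mu (ri Xi) Q & (I_divergence P Q < +oo)%E) ->
          cl_rI (expfam mu Xi) P].
Proof.
split.
- move=> vartheta Q F theta P _ QQ _ _ /is_QF_density Pp tv0.
  have mF := measurable_closure F; split; first exact (I_divergence_cvg0 mF Pp QQ tv0).
  by split; apply: filterS => n; have [] := I_divergence_finP mF Pp (QQ n).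
- move=> Xi F theta P _ _ _ /is_QF_density Pp; have mF := measurable_closure F.
  split=> [[Q QXi D0]|[Q QXi tv0]].
    have [vartheta [Xit QQ]] := expfam_choice QXi.
    have /fine_cvgP[[N _ finD] _] := D0.
    (* The divergence is finite only eventually, whereas every member must lie in the restricted
       family; the sequence is shifted. *)
    exists (fun n => Q (n + N)%N).
      move=> n; exists (vartheta (n + N)%N) => //; split=> //.
      by apply/(I_divergence_finP mF Pp (QQ _)); apply: finD; exact: leq_addl.
    by have := tv_dist_cvg0 mF Pp QQ D0; rewrite -(cvg_shiftn N).
  have [vartheta [Xit QQ]] := expfam_choice QXi; exists Q.
    by move=> n; exists (vartheta n) => //; have [] := Xit n.
  apply: (I_divergence_cvg0 mF Pp QQ tv0); near=> n.
  by apply/(I_divergence_finP mF Pp (QQ n)); have [] := Xit n.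
- move=> Xi XiT cvxXi P [Q QXi tv0] [Q0 [y0 riy0 QQ0] DQ0].
  have [vartheta [Xit QQ]] := expfam_choice QXi.
  have domXi : Xi `<=` dom_Lambda mu by move=> t /XiT[].
  have /choice[phi tvphi] : forall k, exists n,
      (tv_dist P (Q n) <= (1 / (2 ^ k.+1)%:R)%:E)%E.
    by move=> k; apply: (@filter_ex _ \oo); exact: tv_cvg0_near.
  have [J HJ] := @convex_approximation R d mu Xi mu_neq0 domXi cvxXi P
    (vartheta \o phi) (Q \o phi) (fun n => Xit (phi n)) (fun n => QQ (phi n))
    tvphi y0 Q0 riy0 QQ0 DQ0.
  (* The weights t = 1/(n+2) lie strictly between 0 and 1 already at n = 0. *)
  have /choice[Q' HQ'] : forall n, exists Q', [/\ expfam mu Xi Q',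
      (0 <= I_divergence P Q')%E &
      (I_divergence P Q' <= ((n.+2%:R)^-1 * J)%:E)%E].
    by move=> n; apply: HJ; rewrite invr_gt0 invf_lt1 ltr0n ?ltr1n.
  exists Q'; first by move=> n; have [] := HQ' n.
  apply: (@squeeze_cvge _ _ _ _ (cst 0%E) _ (fun n => ((n.+2%:R)^-1 * J)%:E)).
  + by near=> n; have [_ D0 DJ] := HQ' n; apply/andP.
  + exact: cvg_cst.
  + apply: cvg_EFin; first by near=> n.
    rewrite -(mul0r J); apply: cvgM; last exact: cvg_cst.
    have := @cvg_harmonic R; rewrite -(cvg_shiftn 1).
    by apply: cvg_trans; apply: near_eq_cvg; near=> n; rewrite /harmonic/= addn1.
Unshelve. all: by end_near. Qed.
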